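(* Consider a nonperiodic one-dimensional substitution tiling with interval projection structure and window $\Omega\subset Y$, whose tiling space $V$ and window space $W$ are respectively the expanding and contracting eigenspaces of a primitive matrix $M\in Gl(2,\mathbb{Z})$ with expanding eigenvalue $\lambda>1$, and $|\Omega|\in\mathbb{Q}[\lambda]$. Then for each choice of a half-open interval window $\Omega'\subset Y$ such that (i) $|\Omega'|=|\Omega|$, (ii) $M(\Omega+V)\subset(\Omega'+V)$, (iii) the length of each connected component of $\Omega'\setminus\Pi_Y M(\Omega)$ is in $\mathbb{Q}[\lambda]$, there exists a substitution rule that maps the projection tiling with window $\Omega$ to the locally isomorphic projection tiling with window $\Omega'$. Moreover, for each substitution rule that the tiling admits (with $M$ the matrix associated to the rule) one can identify a window $\Omega'$ with properties (i), (ii), (iii).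
   Context: Interval projection tilings. $V,W\subset\mathbb{R}^2$ are two distinct lines through the origin, neither parallel to a coordinate axis. $Y=\{0\}\times\mathbb{R}$ is the vertical axis, identified with $\mathbb{R}$. $\Pi_V$ is the projection of $\mathbb{R}^2$ onto $V$ parallel to $W$, and $\Pi_Y$ the projection onto $Y$ parallel to $V$. The window $\Omega\subset Y$ is a bounded half-open interval of length $|\Omega|$. The projection tiling with window $\Omega$ is the tiling of the line $V$ by intervals whose vertex set is $\Pi_V(\mathbb{Z}^2\cap(V+\Omega))$; it is a geometric object without labels, and ''nonperiodic'' refers to this geometric tiling. Substitution rules. Given a finite protoset of labelled prototiles (intervals, each with a length and a label), a substitution rule consists of a factor $\lambda>1$ together with a replacement rule assigning to each inflated prototile (scaled by $\lambda$) a finite patch of translated prototiles that covers it exactly. It acts on a labelled tiling by first inflating uniformly by $\lambda$ and then replacing every inflated tile according to its label. Two tilings are locally isomorphic if every finite patch of one occurs (up to translation) in the other, and conversely. A labelled tiling $\mathcal{T}$ is a substitution tiling for $\sigma$ if for every $n\in\mathbb{N}$ there is a tiling $\mathcal{T}'$ locally isomorphic to $\mathcal{T}$ with $\sigma^n\mathcal{T}'=\mathcal{T}$. A geometric tiling admits a substitution rule (is a substitution tiling) if there is a labelling of its tiles with finitely many labels (tiles of different lengths never receiving the same label) such that the labelled tiling is a substitution tiling for some substitution rule. Associated matrix. If $\mathcal{T}=\sigma(\mathcal{T}')$, the inflated tiling $\lambda\mathcal{T}'$ is called the expansion predecessor of $\mathcal{T}$. The vertices of a projection tiling lift to lattice points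 in the strip $V+\Omega$, and consecutive vertices differ by lattice vectors called staircase steps. The vertices of the expansion predecessor are vertices of $\mathcal{T}$ and hence also lift to $\mathbb{Z}^2$. The matrix $M$ associated to a substitution rule is the linear map sending the staircase steps of the tiling to the corresponding steps of the lifted expansion predecessor; it has eigenspaces $V$ and $W$ and acts on $V$ as multiplication by the inflation factor. Algebra. $Gl(2,\mathbb{Z})$ is the group of $2\times2$ integer matrices with determinant $\pm1$; $M$ is primitive if all entries of some power $M^n$, $n\in\mathbb{N}$, are nonzero. $\mathbb{Q}[\lambda]=\mathbb{Q}+\lambda\mathbb{Q}$.
   Formalization: Added: Ω' must be closed at the same end as Π_Y M(Ω), unless Ω or Ω' has no end in Π_Y(Z^2) or Ω' is a lattice translate of Ω; otherwise no rule with matrix M exists. In the converse, the image tiling's window agrees with Ω' up to which end is closed. *)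

(* Defs.v *)
From HB Require Import structures.
From mathcomp Require Import all_boot all_order all_algebra ring.
From mathcomp Require Import all_classical all_reals all_analysis.

Set Implicit Arguments.
Unset Strict Implicit.
Unset Printing Implicit Defensive.

Import Order.TTheory GRing.Theory Num.Theory.
Import numFieldNormedType.Exports.
Local Open Scope classical_set_scope.
Local Open Scope ring_scope.

Section Plane.
Variable R : realType.
Implicit Types v w : 'cV[R]_2.

Definition zvec (z : 'cV[int]_2) : 'cV[R]_2 := map_mx intr z.
Definition zmat (M : 'M[int]_2) : 'M[R]_2 := map_mx intr M.

Definition det2 (u t : 'cV[R]_2) : R := u 0 0 * t 1 0 - u 1 0 * t 0 0.

(* The projection of [z] onto the line spanned by [u], parallel to the line
   spanned by [t], is [pcoord u t z *: u]; see [pcoordP]. *)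
Definition pcoord (u t z : 'cV[R]_2) : R := det2 z t / det2 u t.

Lemma pcoordP (u t z : 'cV[R]_2) : det2 u t != 0 -> exists y, z = pcoord u t z *: u + y *: t.
Proof.
rewrite /pcoord /det2 => h; exists ((u 0 0 * z 1 0 - u 1 0 * z 0 0) /
  (u 0 0 * t 1 0 - u 1 0 * t 0 0)).
apply/colP => i; rewrite !mxE.
case: (unliftP 0 i) => [j|] ->; last by field.
have -> : lift 0 j = 1 by rewrite (ord1 j); apply/val_inj.
by field.
Qed.

(* Y is the vertical axis, identified with R by its coordinate along [yvec];
   V is the line spanned by [v], identified with R by the coordinate along [v]
   (lengths on V are therefore measured in units of the norm of [v]). *)
Definition yvec : 'cV[R]_2 := delta_mx 1 0.

Definition PiV v w (z : 'cV[R]_2) : R := pcoord v w z.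
Definition PiY v (z : 'cV[R]_2) : R := pcoord yvec v z.

(* Both kinds of half-open interval are allowed: the window is [wlo, whi[ when
   [wside] is true and ]wlo, whi] when it is false. *)
Record window := Window {
  wside : bool;
  wlo : R;
  whi : R;
  wlohi : wlo < whi }.

Definition wset (O : window) : set R :=
  [set` Interval (BSide (wside O) (wlo O)) (BSide (wside O) (whi O))].

Definition wlen (O : window) : R := whi O - wlo O.

(* The length of a bounded interval; it is 0 on the empty set. *)
Definition ilen (A : set R) : R := sup A - inf A.

(* V + A, for a subset A of Y *)
Definition strip v (A : set R) : set 'cV[R]_2 :=
  [set z | exists x y, A y /\ z = x *: v + y *: yvec].

Definition strip_lattice v (O : window) : set 'cV[int]_2 :=
  [set z | strip v (wset O) (zvec z)].

(* The vertex set of the projection tiling with window [O]. *)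
Definition proj_vertices v w (O : window) : set R :=
  [set PiV v w (zvec z) | z in strip_lattice v O].

Definition nonperiodic (X : set R) : Prop :=
  forall t, t != 0 -> [set x + t | x in X] <> X.

(* Lattice vectors between (lifts of) consecutive vertices, from left to right. *)
Definition staircase_step v w (O : window) (d : 'cV[int]_2) : Prop :=
  exists z, [/\ strip_lattice v O z, strip_lattice v O (z + d),
    PiV v w (zvec z) < PiV v w (zvec (z + d)) &
    forall x, proj_vertices v w O x ->
      ~ (PiV v w (zvec z) < x < PiV v w (zvec (z + d)))].

Definition Qadj (lam : R) : set R :=
  [set x | exists a b : rat, x = ratr a + ratr b * lam].

(* Pi_Y (M A), for a subset A of Y *)
Definition PiYM v (M : 'M[int]_2) (A : set R) : set R :=
  [set PiY v (zmat M *m (y *: yvec)) | y in A].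

Definition admissible_window v (M : 'M[int]_2) (lam : R) (O O' : window) : Prop :=
  [/\ wlen O' = wlen O,
      [set zmat M *m z | z in strip v (wset O)] `<=` strip v (wset O') &
      forall y, (wset O' `\` PiYM v M (wset O)) y ->
        Qadj lam (ilen (connected_component (wset O' `\` PiYM v M (wset O)) y))].

Definition regular_window v (O : window) : Prop :=
  forall z : 'cV[int]_2, PiY v (zvec z) != wlo O /\ PiY v (zvec z) != whi O.

(* Which end of a half-open window is closed matters only if an end of the
   window is the projection of a lattice point.  The ends of [O] and [O'] match
   if Pi_Y (M O) and [O'] are closed at the same end, or if one of the two
   windows can be closed at its other end without changing its tiling, or if
   the two tilings are translates of each other by a lattice translation of the
   window.  If they do not match, no substitution rule maps the tiling with
   window [O] to the one with window [O']: the latter would be a limit of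
   translates of itself with the window approached from the wrong side. *)
Definition matching_ends v (M : 'M[int]_2) (O O' : window) : Prop :=
  [\/ exists2 U : window, wset U = PiYM v M (wset O) & wside U = wside O',
      regular_window v O,
      regular_window v O' |
      exists z : 'cV[int]_2, wset O' = [set y + PiY v (zvec z) | y in wset O]].

Definition same_ends (O O' : window) : Prop := wlo O = wlo O' /\ whi O = whi O'.

(* A label determines the length of its prototile; a patch of tiles covering
   an interval exactly is given by its labels, from left to right. *)
Record subst_rule := SubstRule {
  label : finType;
  tlen : label -> R;
  tlen_gt0 : forall l, 0 < tlen l;
  inflation : R;
  inflation_gt1 : 1 < inflation;
  repl : label -> seq label;
  repl_len : forall l, \sum_(k <- repl l) tlen k = inflation * tlen l }.

Section Labelled.
Variable s : subst_rule.

(* The pair (x, l) is the tile [x, x + tlen l] with label l. *)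
Notation tiles := (set (R * label s)).
Implicit Types T : tiles.

Definition is_tiling T : Prop :=
  forall x : R, exists! t, T t /\ t.1 <= x < t.1 + tlen t.2.

Definition vertices T : set R := [set t.1 | t in T].

Definition translate (a : R) T : tiles := [set (t.1 + a, t.2) | t in T].

Definition patches_occur T T' : Prop :=
  forall P, finite_set P -> P `<=` T -> exists a, translate a P `<=` T'.

Definition loc_iso T T' : Prop := patches_occur T T' /\ patches_occur T' T.

Definition subst T : tiles :=
  [set u | exists t i, [/\ T t, (i < size (repl t.2))%N &
     u = (inflation s * t.1 + \sum_(k <- take i (repl t.2)) tlen k,
          nth t.2 (repl t.2) i)]].

Definition is_subst_tiling T : Prop :=
  is_tiling T /\
  forall n, exists T', [/\ is_tiling T', loc_iso T T' & iter n subst T' = T].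

(* [T] is a labelling of the projection tiling with window [O]. *)
Definition labels v w (O : window) T : Prop :=
  is_tiling T /\ vertices T = proj_vertices v w O.

(* [M] is the matrix associated to the rule: it sends a staircase step [d] to
   the difference of the lifts [u], [u'] of the end points of any tile of the
   expansion predecessor that is the inflation of a tile of T' with the length
   of the projection of [d]. *)
Definition associated_matrix v w (O : window) T (M : 'M[int]_2) : Prop :=
  forall T', is_tiling T' -> loc_iso T T' -> subst T' = T ->
  forall t d u u', T' t -> staircase_step v w O d ->
    tlen t.2 = PiV v w (zvec d) ->
    strip_lattice v O u -> PiV v w (zvec u) = inflation s * t.1 ->
    strip_lattice v O u' -> PiV v w (zvec u') = inflation s * (t.1 + tlen t.2) ->
  u' - u = M *m d.

End Labelled.

Definition is_geom_subst_tiling v w (O : window) : Prop :=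
  exists (s : subst_rule) (T : set (R * label s)),
    labels v w O T /\ is_subst_tiling T.

End Plane.

(* Main.v *)
(* A vertex of the tiling with lower window end a is a lattice point z whose height
   eta = Y z - a lies in the window.  Inflation by M sends z to M z and eta to
   mu * eta + delta, so the vertices of the tiling with window O' inside an inflated
   tile only depend on eta.  By the length conditions all relevant cut points of the
   window are heights of points of a finer lattice (1/n) Z^2.  Pulling a cut point
   back contracts its coordinate along V by 1/lam, hence the cut points whose
   V-coordinate is below a suitable bound form a finite set stable under pulling
   back; the pieces into which they divide the window are the labels.
   Conversely, the tiling sigma T is locally isomorphic to T, which makes its vertices
   lift to a strip of the same width.  If e is an end of the set of heights of the
   tiles with a given label, then local isomorphism and the substitution rule give
   e + c = nu * e' + Y q, where c is the shift of the window, e' is such an end for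
   another label and q is a lattice vector.  As there are finitely many labels these
   relations contain a cycle, so e - c / (nu - 1) lies in Q[lambda]; the lower end
   of the window is one of the e. *)
Require Import Defs.
From HB Require Import structures.
From mathcomp Require Import all_boot all_order all_algebra finmap ring lra zify.
From mathcomp Require Import all_classical all_reals all_analysis.

Set Implicit Arguments.
Unset Strict Implicit.
Unset Printing Implicit Defensive.

Import Order.TTheory GRing.Theory Num.Theory.
Import numFieldNormedType.Exports.
Local Open Scope classical_set_scope.
Local Open Scope ring_scope.

(** The ends of the windows are the obstacle that shapes the construction of the rule, since a
    negative contraction factor exchanges them. There are two labelling schemes. In one, labels are
    constant on half-open pieces and windows of both kinds occur; a patch then survives a small
    one-sided move of the window, so all the tilings are locally isomorphic. In the other, cut
    points are labelled separately, so the kind of the window stays fixed whatever the sign of the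
    factor, but only lattice translates of the window are compared. The second scheme serves the
    last case of [matching_ends]. In the converse, lower and upper ends have to be treated together
    for the same reason: a negative nu exchanges them. Moreover the matrix N of the given rule is
    not assumed to be related to M. It must first be shown to scale the coordinate along V on the
    whole lattice, which makes V an eigenspace of N. *)

Section Finite.
Variable R : realType.

Lemma finite_min (T : choiceType) (f : T -> R) (A : set T) :
  finite_set A -> A !=set0 -> exists2 z, A z & forall z', A z' -> f z <= f z'.
Proof.
move=> /finite_seqP[s ->]; elim: s => [|a s IH] [z /=]; first by rewrite inE.
move=> _; case: (pselect ([set` s] !=set0)) => [/IH[b bs bmin]|s0].
  have [ab|ba] := leP (f a) (f b).
    exists a => [|z']; rewrite /= inE ?eqxx// => /orP[/eqP->//|z's].
    exact: le_trans ab (bmin _ z's).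
  exists b => [|z']; rewrite /= inE ?bs ?orbT// => /orP[/eqP->|/bmin//].
  exact: ltW.
exists a => [|z']; rewrite /= inE ?eqxx// => /orP[/eqP->//|z's].
by case: s0; exists z'.
Qed.

(** Exchanges quantifiers by taking the least of finitely many radii. It gives the common size of a
    window move in [lab_shift] and [ptiling_occur], and the common distance in [is_end_union]. *)
Lemma finite_radius (T : eqType) (A : set T) (Q : T -> R -> Prop) :
  finite_set A ->
  (forall x, A x -> exists2 e, 0 < e & forall t, 0 < t < e -> Q x t) ->
  exists2 e, 0 < e & forall x t, A x -> 0 < t < e -> Q x t.
Proof.
move=> /finite_seqP[s ->]; elim: s => [|a s IH] h; first by exists 1.
have [e1 e1_gt0 he1] := h a (mem_head _ _).
have [|e2 e2_gt0 he2] := IH.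
  by move=> x xs; apply: h; rewrite /= inE; apply/orP; right.
exists (Num.min e1 e2) => [|x t]; first by rewrite lt_min e1_gt0.
rewrite /= inE lt_min => /orP[/eqP->|xs] /and3P[t0 t1 t2].
  by apply: he1; rewrite t0.
by apply: he2; rewrite ?t0.
Qed.

End Finite.

(* A cut and project scheme: [px] and [py] are the coordinates of the
   projections of the lattice [G] to the tiling line and to the window line. *)
Record cutproj (R : realType) (G : zmodType) := CutProj {
  px : {additive G -> R};
  py : {additive G -> R};
  px_inj : injective px;
  py_inj : injective py;
  cp_finite : forall K : R, finite_set [set z | `|px z| <= K /\ `|py z| <= K];
  cp_up : forall e, 0 < e -> exists q, 0 < px q /\ 0 < py q < e;
  cp_down : forall e, 0 < e -> exists q, 0 < px q /\ - e < py q < 0 }.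

(** * First return to a window in an abstract cut and project scheme *)

Section Window.
Variables (R : realType) (G : zmodType) (C : cutproj R G) (len : R).
Hypothesis len_gt0 : 0 < len.
Notation X := (px C).
Notation Y := (py C).

Lemma py_dense a b : a < b -> exists k, a < Y k < b.
Proof.
move=> ab; have [|q [_ /andP[q0 qe]]] := @cp_up _ _ C (b - a); first by rewrite subr_gt0.
exists (q *~ (Num.floor (a / Y q) + 1)); rewrite raddfMz -mulrzl.
have := floor_le_tmp (a / Y q); have := floorD1_gt (a / Y q).
rewrite ltr_pdivrMr// intrD => h1; rewrite ler_pdivlMr// => h2.
by apply/andP; split=> //; rewrite mulrDl; lra.
Qed.

Lemma bounded_finite K : finite_set [set z | `|X z| <= K /\ `|Y z| <= len].
Proof.
apply: sub_finite_set (cp_finite C (Num.max K len)) => z [h1 h2] /=.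
by rewrite !le_max h1 h2 orbT.
Qed.

(** Only finitely many vectors have both length at most 1 and height change at most [len], so there
    is a shortest one. The uniform bound is what lets a walk reach every vertex. *)
Lemma step_gap : exists2 e, 0 < e & forall q, 0 < X q -> `|Y q| <= len -> e <= X q.
Proof.
have [[q [q0 qY q1]]|no] := pselect (exists q, [/\ 0 < X q, `|Y q| <= len & X q <= 1]).
  have [||z [z0 zY z1] zmin] := @finite_min R G X
      [set q | [/\ 0 < X q, `|Y q| <= len & X q <= 1]].
  - apply: sub_finite_set (bounded_finite 1) => z [z0 zY z1] /=.
    by rewrite gtr0_norm.
  - by exists q.
  exists (X z) => // q' q'0 q'Y; have [q'1|/ltW q'1] := leP (X q') 1; first exact: zmin.
  exact: le_trans q'1.
exists 1 => // q q0 qY; rewrite leNgt; apply/negP => q1; apply: no.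
by exists q; split=> //; exact: ltW.
Qed.

(* [win s] is the window of length [len] with lower end 0, closed at its lower
   end if [s] and at its upper end otherwise. *)
Definition win (s : bool) (y : R) : bool :=
  if s then 0 <= y < len else 0 < y <= len.

Lemma win_bounds s y : win s y -> 0 <= y <= len.
Proof. by case: s => /andP[h1 h2]; apply/andP; split=> //; exact: ltW. Qed.

Lemma win_open s y : 0 < y < len -> win s y.
Proof. by case: s => /andP[h1 h2]; apply/andP; split=> //; exact: ltW. Qed.

Lemma win_diff s y y' : win s y -> win s y' -> `|y - y'| <= len.
Proof. by move=> /win_bounds h /win_bounds h'; rewrite ler_norml; lra. Qed.

(** From the lower half of the window a small upward vector stays inside, from the upper half a
    small downward one; the negated vectors lead to the left. The resulting [B] bounds all tile
    lengths. *)
Lemma win_gap : exists2 B, 0 < B &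
  forall s y, win s y ->
    (exists q, [/\ 0 < X q, X q <= B & win s (y + Y q)]) /\
    (exists q, X q < 0 /\ win s (y + Y q)).
Proof.
have h : 0 < len / 2 by rewrite divr_gt0.
have [q1 [q1X q1Y]] := cp_up C h; have [q2 [q2X q2Y]] := cp_down C h.
exists (X q1 + X q2); first exact: addr_gt0.
move=> s y /win_bounds yb; split; have [yl|yl] := ltP y (len / 2).
- by exists q1; split=> //; [lra|apply: win_open; lra].
- by exists q2; split=> //; [lra|apply: win_open; lra].
- by exists (- q2); rewrite !raddfN; split=> //; [lra|apply: win_open; lra].
- by exists (- q1); rewrite !raddfN; split=> //; [lra|apply: win_open; lra].
Qed.

Definition is_nstep s y q := [/\ 0 < X q, win s (y + Y q) &
  forall q', 0 < X q' -> win s (y + Y q') -> X q <= X q'].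

Lemma is_nstep_uniq s y q q' : is_nstep s y q -> is_nstep s y q' -> q = q'.
Proof.
move=> [h1 h2 h3] [k1 k2 k3]; apply: (px_inj (c := C)); apply/eqP.
by rewrite eq_le h3// k3.
Qed.

(** The first return vector depends on the height alone. It is defined at every real height, because
    the representatives chosen for labels need not be heights of lattice points. *)
Definition nstep s y : G := xget 0 (is_nstep s y).

Lemma nstepP s y : win s y -> is_nstep s y (nstep s y).
Proof.
move=> yW; rewrite /nstep; case: xgetP => [_ _ //|no].
have [B _ /(_ _ _ yW)[[q [q0 qB qW]] _]] := win_gap.
have [||z [z0 zB zW] zmin] := @finite_min R G X
    [set q | [/\ 0 < X q, X q <= B & win s (y + Y q)]].
- apply: sub_finite_set (bounded_finite B) => z [z0 zB zW] /=.
  rewrite gtr0_norm//; split=> //.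
  by have := win_diff zW yW; rewrite addrC addKr.
- by exists q.
case: (no z); split=> // q' q'0 q'W; have [q'B|/ltW q'B] := leP (X q') B.
  exact: zmin.
exact: le_trans q'B.
Qed.

Lemma nstep_gt0 s y : win s y -> 0 < X (nstep s y).
Proof. by case/nstepP. Qed.

Lemma nstep_win s y : win s y -> win s (y + Y (nstep s y)).
Proof. by case/nstepP. Qed.

Lemma nstep_le s y q : win s y -> 0 < X q -> win s (y + Y q) -> X (nstep s y) <= X q.
Proof. by case/nstepP => _ _ h; exact: h. Qed.

Lemma nstep_bounded : exists2 B, 0 < B & forall s y, win s y -> X (nstep s y) <= B.
Proof.
have [B B0 hB] := win_gap; exists B => // s y yW.
have [[q [q0 qB qW]] _] := hB _ _ yW.
exact: le_trans (nstep_le yW q0 qW) qB.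
Qed.

Fixpoint walk s y n : G :=
  if n is n'.+1 then nstep s y + walk s (y + Y (nstep s y)) n' else 0.

Lemma walk_win s y n : win s y -> win s (y + Y (walk s y n)).
Proof.
elim: n y => [|n IH] y yW /=; first by rewrite raddf0 addr0.
by rewrite raddfD addrA; apply: IH; exact: nstep_win.
Qed.

Lemma walkS s y n :
  walk s y n.+1 = walk s y n + nstep s (y + Y (walk s y n)).
Proof.
elim: n y => [|n IH] y; first by rewrite /= raddf0 !addr0 add0r.
by rewrite -[LHS]/(_ + walk _ _ n.+1) IH /= raddfD !addrA.
Qed.

Lemma walk_lt s y m n : win s y -> (m < n)%N -> X (walk s y m) < X (walk s y n).
Proof.
move=> yW; move: m n; apply: (homo_ltn lt_trans) => n.
by rewrite walkS raddfD ltrDl nstep_gt0// walk_win.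
Qed.

Lemma walk_ge0 s y n : win s y -> 0 <= X (walk s y n).
Proof.
case: n => [|n] yW; first by rewrite raddf0.
by rewrite -(raddf0 X) ltW// (@walk_lt s y 0).
Qed.

Lemma walk_inj s y : win s y -> injective (walk s y).
Proof.
move=> yW m n mn; case: (ltngtP m n) => // /(walk_lt yW); by rewrite mn ltxx.
Qed.

(** A first return never overshoots [g] and has length at least [e], so induction on a bound for
    [X g / e] applies. *)
Lemma walkP s y g : win s y -> win s (y + Y g) -> 0 <= X g ->
  exists n, walk s y n = g.
Proof.
have [e e0 he] := step_gap.
move=> yW gW g0.
have := archi_boundP (divr_ge0 g0 (ltW e0)); move: (Num.bound _) => N.
rewrite ltr_pdivrMr// => gN; elim: N y g yW gW g0 gN => [|N IH] y g yW gW g0 gN.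
  by move: gN; rewrite mul0r ltNge g0.
move: g0; rewrite le_eqVlt => /orP[/eqP g0|g0].
  by exists 0%N; apply: (px_inj (c := C)); rewrite -g0 raddf0.
have ng := nstep_le yW g0 gW.
have yn : `|Y (nstep s y)| <= len.
  by have := win_diff (nstep_win yW) yW; rewrite addrC addKr.
have := he _ (nstep_gt0 yW) yn => en.
have [|||n hn] := IH (y + Y (nstep s y)) (g - nstep s y) (nstep_win yW).
- by rewrite raddfB -addrA [X in _ + X]addrC subrK.
- by rewrite raddfB subr_ge0.
- by rewrite raddfB; move: gN; rewrite -natr1 mulrDl mul1r; lra.
by exists n.+1; rewrite /= hn addrC subrK.
Qed.

Lemma vertex_below a x s : exists z, win s (Y z - a) /\ X z <= x.
Proof.
have [e e0 he] := step_gap.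
have [z0 z0Y] : exists k, a < Y k < a + len by apply: py_dense; rewrite ltrDl.
have z0W : win s (Y z0 - a) by apply: win_open; lra.
have back N : exists z, win s (Y z - a) /\ X z <= X z0 - N%:R * e.
  elim: N => [|N [z [zW zX]]]; first by exists z0; rewrite mul0r subr0.
  have [B _ /(_ _ _ zW)[_ [q [q0 qW]]]] := win_gap.
  exists (z + q); split; first by rewrite raddfD addrAC.
  have := he (- q); rewrite !raddfN oppr_gt0 normrN => /(_ q0).
  have := win_diff qW zW; rewrite addrC addKr => h /(_ h).
  by rewrite raddfD -natr1 mulrDl mul1r; lra.
have [x0|x0] := leP (X z0) x; first by exists z0.
have : 0 <= (X z0 - x) / e by rewrite divr_ge0 ?subr_ge0// ltW.
move/archi_boundP; move: (Num.bound _) => N; rewrite ltr_pdivrMr// => hN.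
have [z [zW zX]] := back N; exists z; split=> //; lra.
Qed.

Lemma tile_exists a x s : exists z, [/\ win s (Y z - a), X z <= x &
  x < X z + X (nstep s (Y z - a))].
Proof.
have [z0 [z0W z0x]] := vertex_below a x s.
have [||z [zW z0z zx] zmax] := @finite_min R G (fun z => - X z)
    [set z | [/\ win s (Y z - a), X z0 <= X z & X z <= x]].
- apply: sub_finite_set (cp_finite C (`|x| + `|X z0| + `|a| + len)) => z [zW z1 z2] /=.
  have := win_bounds zW; rewrite !ler_norml.
  have := ler_norm x; have := ler_norm (- x); have := ler_norm (X z0).
  have := ler_norm (- X z0); have := ler_norm a; have := ler_norm (- a).
  by rewrite !normrN => *; split; lra.
- by exists z0.
exists z; split=> //; rewrite ltNge; apply/negP => h.
have n0 := nstep_gt0 zW.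
have /= := zmax (z + nstep s (Y z - a)); rewrite raddfD raddfD.
move=> zm; have : - X z <= - (X z + X (nstep s (Y z - a))); last lra.
by apply: zm; split; [rewrite addrAC nstep_win|lra|lra].
Qed.

Lemma tile_uniq a x s z z' : win s (Y z - a) -> win s (Y z' - a) ->
  X z <= x < X z + X (nstep s (Y z - a)) ->
  X z' <= x < X z' + X (nstep s (Y z' - a)) -> z = z'.
Proof.
have aux u u' : win s (Y u - a) -> win s (Y u' - a) -> X u < X u' ->
    X u + X (nstep s (Y u - a)) <= X u'.
  move=> uW u'W uu'; rewrite -lerBrDl -raddfB; apply: nstep_le => //.
    by rewrite raddfB subr_gt0.
  by rewrite raddfB addrC addrA subrK.
move=> zW z'W h h'; apply: (px_inj (c := C)).
case: (ltgtP (X z) (X z')) => // /aux => [/(_ zW z'W)|/(_ z'W zW)]; lra.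
Qed.

End Window.

(** * Labels and substitution rules for half-open windows *)

Section Rule.
Variables (R : realType) (G : zmodType) (C : cutproj R G) (len : R).
Hypothesis len_gt0 : 0 < len.
Notation X := (px C).
Notation Y := (py C).
Notation win := (win len).
Notation nstep := (nstep C len).
Notation walk := (walk C len).

Variables (lam mu : R) (M M' : G -> G).
Hypothesis lam_gt1 : 1 < lam.
Hypothesis mu_neq0 : mu != 0.
Hypothesis XM : forall z, X (M z) = lam * X z.
Hypothesis YM : forall z, Y (M z) = mu * Y z.
Hypothesis MK : cancel M' M.

Variables (den : nat) (delta : R) (zlen zdelta : G).
Hypothesis den_gt0 : (0 < den)%N.
Hypothesis len_cut : len = Y zlen / den%:R.
Hypothesis delta_cut : delta = Y zdelta / den%:R.

(* With [mode = None] both kinds of half-open windows occur, and the side of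
   the window is reversed if [mu < 0].  With [mode = Some s] all windows are of
   kind [s]; the ends of the pieces of the window that carry a label are then
   labelled separately. *)
Variable mode : option bool.

Definition good (s : bool) := if mode is Some s0 then s == s0 else true.
Definition side (s : bool) := if mode is Some _ then s else s (+) (mu < 0).

Hypothesis img_win : forall s y, good s -> win s y -> win (side s) (mu * y + delta).

Lemma good_side s : good s -> good (side s).
Proof. by rewrite /good /side; case: mode. Qed.

Lemma sideK : involutive side.
Proof. by rewrite /side => s; case: mode => //; rewrite -addbA addbb addbF. Qed.

Definition lep (s : bool) (p y : R) := if s then p <= y else p < y.

(** With a fixed kind of window both comparisons are recorded, so that [y = p] is detected.
    Otherwise the single comparison suited to the side [s] is stored twice. *)
Definition bits (s : bool) (y p : R) : bool * bool :=
  if mode is Some _ then (p <= y, p < y) else (lep s p y, lep s p y).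

(** A negative factor reverses the order: [<=] becomes the negation of [<], hence negation together
    with an exchange. *)
Definition flip (b : bool * bool) := if mu < 0 then (~~ b.2, ~~ b.1) else b.

Lemma winE s y : win s y = lep s 0 y && ~~ lep s len y.
Proof. by case: s; rewrite /= -?leNgt -?ltNge. Qed.

Lemma bits_lep s s2 y y2 p : good s -> good s2 ->
  bits s y p = bits s2 y2 p -> lep s p y = lep s2 p y2.
Proof.
rewrite /good /bits; case: mode => [s0|_ _ []//].
by move=> /eqP-> /eqP-> []; case: s0.
Qed.

Lemma bitsD s y t p : bits s (y + t) p = bits s y (p - t).
Proof. by rewrite /bits /lep lerBlDr ltrBlDr. Qed.

Lemma bits_side s y p : bits (side s) (mu * y) p = flip (bits s y (p / mu)).
Proof.
rewrite /bits /side /lep /flip; have [mu_lt0|mu_ge0] := ltP mu 0.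
  rewrite (ler_ndivrMr _ _ mu_lt0) (ltr_ndivrMr _ _ mu_lt0) [y * mu]mulrC.
  by case: mode => [_|]; [|case: s]; rewrite /= -?leNgt -?ltNge.
have mu_gt0 : 0 < mu by rewrite lt_neqAle eq_sym mu_neq0.
rewrite (ler_pdivrMr _ _ mu_gt0) (ltr_pdivrMr _ _ mu_gt0) [y * mu]mulrC.
by case: mode => [//|]; case: s.
Qed.

Lemma bits_small s y p : win s y -> p < 0 -> bits s y p = (true, true).
Proof.
move=> /win_bounds yb p0; have py : p < y by lra.
by rewrite /bits /lep py ltW//; case: mode; case: s.
Qed.

Lemma bits_large s y p : win s y -> len < p -> bits s y p = (false, false).
Proof.
move=> /win_bounds yb p0; have py : y < p by lra.
by rewrite /bits /lep !leNgt py ltNge ltW//; case: mode; case: s.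
Qed.

Variable B : R.
Hypothesis nstep_leB : forall s y, win s y -> X (nstep s y) <= B.

Notation N := (den%:R : R).

Let lam_gt0 : 0 < lam. Proof. exact: lt_trans lam_gt1. Qed.

Lemma B_gt0 : 0 < B.
Proof.
have h : win true (len / 2) by apply: win_open;
  rewrite divr_gt0// ltr_pdivrMr// ltr_pMr// ltr1n.
exact: lt_le_trans (nstep_gt0 C len_gt0 h) (nstep_leB h).
Qed.

Lemma N_gt0 : 0 < N. Proof. by rewrite ltr0n. Qed.

Definition cut (z : G) : R := Y z / N.

(** Vectors [q] inside an inflated tile have length at most [lam * B], and [q *+ den] moves a cut by
    the height of [q]. The first two terms leave room for the moved window ends. The last one solves
    [K = (K + c) / lam], where [c] bounds the displacement by [zdelta] and [q *+ den], so that
    pulling a cut back stays below the bound. *)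
Definition cutbound : R :=
  `|X zlen| + N * (lam * B) + (`|X zdelta| + N * (lam * B)) / (lam - 1).

Let NlB_ge0 : 0 <= N * (lam * B).
Proof. by rewrite !mulr_ge0// ltW// B_gt0. Qed.

Let lam1_gt0 : 0 < lam - 1. Proof. by rewrite subr_gt0. Qed.

Lemma cutbound_len : `|X zlen| + N * (lam * B) <= cutbound.
Proof. by rewrite lerDl divr_ge0 ?(ltW lam1_gt0)// addr_ge0. Qed.

Lemma cutbound_delta : (cutbound + (`|X zdelta| + N * (lam * B))) / lam <= cutbound.
Proof.
rewrite ler_pdivrMr// -[lam in leRHS](subrK 1) mulrDr mulr1 addrC lerD2r.
by rewrite -ler_pdivrMr// ler_wpDl// addr_ge0.
Qed.

(** Infinitely many cuts are compared, so that a pulled back cut need not be shown to meet the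
    window; [labP] reduces this to the finite [cutset]. *)
Definition eqv s y s2 y2 := forall z, `|X z| <= cutbound ->
  bits s y (cut z) = bits s2 y2 (cut z).

Lemma normX_mul q : `|X q| <= lam * B -> `|X (q *+ den)| <= N * (lam * B).
Proof.
by move=> h; rewrite raddfMn -[X q *+ den]mulr_natl normrM ger0_norm// ler_wpM2l.
Qed.

Lemma cutB z z' q : cut (z - z' - q *+ den) = cut z - cut z' - Y q.
Proof.
rewrite /cut !raddfB raddfMn !mulrBl -[Y q *+ den]mulr_natl.
by rewrite [N * _]mulrC mulfK// gt_eqF// N_gt0.
Qed.

(** Moved by [q], the window ends 0 and [len] are the cuts of [- (q *+ den)] and [zlen - q *+ den],
    both within the bound. *)
Lemma eqv_win s y s2 y2 q : good s -> good s2 -> eqv s y s2 y2 ->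
  `|X q| <= lam * B -> win s (y + Y q) = win s2 (y2 + Y q).
Proof.
move=> gs gs2 e qB; rewrite !winE.
have h p : `|X p| <= `|X zlen| ->
    lep s (cut p) (y + Y q) = lep s2 (cut p) (y2 + Y q).
  move=> pl; apply: bits_lep => //; rewrite !bitsD -[cut p]subr0.
  rewrite -(mul0r N^-1) -(raddf0 Y) -cutB; apply: e.
  apply: le_trans cutbound_len; rewrite subr0 raddfB (le_trans (ler_normB _ _))//.
  by rewrite lerD// normX_mul.
by have := h 0; have := h zlen; rewrite /cut -len_cut raddf0 normr0 raddf0 mul0r => -> // ->.
Qed.

(** A cut [z] seen from the image height is the cut [M' (z - zdelta - q *+ den)] seen from the
    original one. Since [M'] divides the coordinate along V by [lam], this cut is again below
    [cutbound]; a negative [mu] merely applies [flip] to both sides. *)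
Lemma eqv_img s y s2 y2 q : eqv s y s2 y2 -> `|X q| <= lam * B ->
  eqv (side s) (mu * y + delta + Y q) (side s2) (mu * y2 + delta + Y q).
Proof.
move=> e qB z zK; rewrite !bitsD !bits_side; congr flip.
have -> : (cut z - Y q - delta) / mu = cut (M' (z - zdelta - q *+ den)).
  have -> : cut (M' (z - zdelta - q *+ den)) = cut (z - zdelta - q *+ den) / mu.
    by rewrite /cut -{2}[z - _ - _]MK YM mulrAC [mu * _]mulrC mulfK.
  by rewrite cutB delta_cut addrAC.
apply: e; rewrite -(ler_pM2l lam_gt0) -{1}(gtr0_norm lam_gt0) -normrM -XM MK.
rewrite -ler_pdivrMl// mulrC; apply: le_trans cutbound_delta.
rewrite ler_pM2r ?invr_gt0// -addrA -opprD raddfB raddfD.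
rewrite (le_trans (ler_normB _ _))// lerD// (le_trans (ler_normD _ _))//.
by rewrite lerD// normX_mul.
Qed.

(** Only vectors of length at most [B] compete for the first return, and [eqv_win] covers these. *)
Lemma eqv_nstep s y s2 y2 : good s -> good s2 -> win s y -> win s2 y2 ->
  eqv s y s2 y2 -> nstep s y = nstep s2 y2.
Proof.
move=> gs gs2 yW y2W e; apply: (is_nstep_uniq (s := s) (y := y)); first exact: nstepP.
have leB z : 0 < X z -> X z <= B -> `|X z| <= lam * B.
  move=> z0 zB; rewrite gtr0_norm// (le_trans zB)// ler_peMl ?ltW//.
  exact: B_gt0.
have [n0 nW nmin] := nstepP C len_gt0 y2W.
have nB := nstep_leB y2W.
split=> // [|q q0 qW]; first by rewrite (eqv_win gs gs2 e) ?leB.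
have [qB|/ltW qB] := leP (X q) B; last exact: le_trans qB.
by apply: nmin => //; rewrite -(eqv_win gs gs2 e) ?leB.
Qed.

Definition cutset : {fset G} :=
  fset_set [set z | `|X z| <= cutbound /\ `|cut z| <= len].

Lemma in_cutset z : (z \in cutset) = (`|X z| <= cutbound) && (`|cut z| <= len).
Proof.
rewrite /cutset in_fset_set; first by apply/idP/andP; rewrite inE.
apply: sub_finite_set (cp_finite C (Num.max cutbound (len * N))) => u /= [uX uY].
rewrite !le_max uX/=; split=> //; move: uY.
by rewrite /cut normrM normfV (gtr0_norm N_gt0) ler_pdivrMr ?N_gt0// => ->; rewrite orbT.
Qed.

Definition lab s y : {ffun cutset -> bool * bool} :=
  [ffun z => bits s y (cut (val z))].

(** A cut below 0 or above [len] has the same bits at all heights of the window. *)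
Lemma labP s y s2 y2 : win s y -> win s2 y2 ->
  lab s y = lab s2 y2 -> eqv s y s2 y2.
Proof.
move=> yW y2W e z zK; have [z0|z0] := ltP (cut z) 0; first by rewrite !bits_small.
have [z1|z1] := ltP len (cut z); first by rewrite !bits_large.
have zc : z \in cutset by rewrite in_cutset zK ger0_norm.
by have /ffunP/(_ (FSetSub zc)) := e; rewrite !ffunE.
Qed.

Lemma eqv_lab s y s2 y2 : eqv s y s2 y2 -> lab s y = lab s2 y2.
Proof.
move=> e; apply/ffunP => -[z zc]; rewrite !ffunE /=; apply: e.
by move: zc; rewrite in_cutset => /andP[].
Qed.

Let L : finType := {ffun cutset -> bool * bool}.

(** A label that no height realises receives the midpoint of the window, so that its length and
    replacement still satisfy what [subst_rule] demands of every label. *)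
Definition rep (l : L) : bool * R :=
  xget (odflt true mode, len / 2)
    [set st | [/\ good st.1, win st.1 st.2 & lab st.1 st.2 = l]].

Lemma repP l : good (rep l).1 /\ win (rep l).1 (rep l).2.
Proof.
rewrite /rep; case: xgetP => [st _ []//|_] /=.
split; first by rewrite /good; case: mode => //=.
by apply: win_open; rewrite divr_gt0// ltr_pdivrMr// ltr_pMr// ltr1n.
Qed.

Lemma rep_eqv s y : good s -> win s y ->
  eqv (rep (lab s y)).1 (rep (lab s y)).2 s y.
Proof.
move=> gs yW; have [gr rW] := repP (lab s y); apply: labP => //.
by rewrite {1 2}/rep; case: xgetP => [st _ []//|/(_ (s, y))[]].
Qed.

Definition tl (l : L) : R := X (nstep (rep l).1 (rep l).2).

Lemma tl_gt0 l : 0 < tl l.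
Proof. by apply: nstep_gt0 => //; case: (repP l). Qed.

Lemma tl_lab s y : good s -> win s y -> tl (lab s y) = X (nstep s y).
Proof.
move=> gs yW; have [gr rW] := repP (lab s y).
by rewrite /tl (eqv_nstep gr gs rW yW (rep_eqv gs yW)).
Qed.

Definition subwalk s y i : G := walk (side s) (mu * y + delta) i.

Definition nsub s y : nat := xget 0%N [set n | subwalk s y n = M (nstep s y)].

(** By [img_win] both ends of the inflated tile have heights in the image window, so the walk from
    the first end reaches the second. *)
Lemma nsubP s y : good s -> win s y -> subwalk s y (nsub s y) = M (nstep s y).
Proof.
move=> gs yW; rewrite /nsub; case: xgetP => [n _ //|no].
have [||n] := @walkP _ _ C _ len_gt0 _ _ (M (nstep s y)) (img_win gs yW).
- by rewrite YM addrAC -mulrDr; apply: img_win => //; exact: nstep_win.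
- by rewrite XM mulr_ge0// ltW// nstep_gt0.
by move=> h; case: (no n).
Qed.

Lemma subwalk_win s y i : good s -> win s y ->
  win (side s) (mu * y + delta + Y (subwalk s y i)).
Proof. by move=> gs yW; apply: walk_win => //; exact: img_win. Qed.

Lemma subwalk_lt s y i j : good s -> win s y -> (i < j)%N ->
  X (subwalk s y i) < X (subwalk s y j).
Proof. by move=> gs yW; apply: walk_lt => //; exact: img_win. Qed.

Lemma subwalk_bounded s y i : good s -> win s y -> (i <= nsub s y)%N ->
  `|X (subwalk s y i)| <= lam * B.
Proof.
move=> gs yW; rewrite ger0_norm ?walk_ge0 ?img_win// => im.
apply: (@le_trans _ _ (X (subwalk s y (nsub s y)))).
  by move: im; rewrite leq_eqVlt => /orP[/eqP->//|/(subwalk_lt gs yW)/ltW].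
by rewrite nsubP// XM ler_pM2l// nstep_leB.
Qed.

Definition sublab s y : seq L :=
  [seq lab (side s) (mu * y + delta + Y (subwalk s y i)) | i <- iota 0 (nsub s y)].

(** The heights along the two walks stay equivalent by [eqv_img], so the next steps agree by
    [eqv_nstep]. *)
Lemma eqv_subwalk s y s2 y2 i : good s -> good s2 -> win s y -> win s2 y2 ->
  eqv s y s2 y2 -> (i <= nsub s y)%N -> subwalk s y i = subwalk s2 y2 i.
Proof.
move=> gs gs2 yW y2W e; elim: i => [//|i IH] im.
have wi := IH (ltnW im); rewrite /subwalk !walkS -!/(subwalk _ _ _) -wi.
congr (_ + _); apply: eqv_nstep; rewrite ?good_side ?subwalk_win//.
  by rewrite wi subwalk_win.
by apply: eqv_img => //; apply: subwalk_bounded => //; exact: ltnW.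
Qed.

Lemma eqv_nsub s y s2 y2 : good s -> good s2 -> win s y -> win s2 y2 ->
  eqv s y s2 y2 -> nsub s y = nsub s2 y2.
Proof.
move=> gs gs2 yW y2W e.
apply: (@walk_inj _ _ C _ len_gt0 (side s2) (mu * y2 + delta)); first exact: img_win.
rewrite -!/(subwalk _ _ _) nsubP// -(eqv_subwalk gs gs2 yW y2W e)// nsubP//.
by rewrite (eqv_nstep gs gs2 yW y2W e).
Qed.

Lemma eqv_sublab s y s2 y2 : good s -> good s2 -> win s y -> win s2 y2 ->
  eqv s y s2 y2 -> sublab s y = sublab s2 y2.
Proof.
move=> gs gs2 yW y2W e; rewrite /sublab -(eqv_nsub gs gs2 yW y2W e).
apply/eq_in_map => i; rewrite mem_iota /= add0n => im.
rewrite -(eqv_subwalk gs gs2 yW y2W e (ltnW im)).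
by apply: eqv_lab; apply: eqv_img => //; apply: subwalk_bounded => //; exact: ltnW.
Qed.

Lemma sum_sublab s y i : good s -> win s y -> (i <= nsub s y)%N ->
  \sum_(k <- take i (sublab s y)) tl k = X (subwalk s y i).
Proof.
move=> gs yW im; rewrite /sublab -map_take take_iota (minn_idPl im) big_map.
elim: i im => [|i IH] im; first by rewrite big_nil raddf0.
rewrite -addn1 iotaD big_cat /= big_seq1 IH 1?ltnW// add0n addn1.
rewrite tl_lab ?good_side ?subwalk_win// /subwalk walkS raddfD.
by rewrite addrC.
Qed.

Definition repl_lab (l : L) : seq L := sublab (rep l).1 (rep l).2.

Lemma repl_lab_len l : \sum_(k <- repl_lab l) tl k = lam * tl l.
Proof.
have [gr rW] := repP l; rewrite /repl_lab.
rewrite -[sublab _ _]take_size size_map size_iota sum_sublab//.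
by rewrite nsubP// XM.
Qed.

Lemma repl_labE s y : good s -> win s y -> repl_lab (lab s y) = sublab s y.
Proof.
move=> gs yW; have [gr rW] := repP (lab s y).
exact: eqv_sublab (rep_eqv gs yW).
Qed.

Definition rule : subst_rule R := SubstRule tl_gt0 lam_gt1 repl_lab_len.

Definition ptiling s a : set (R * label rule) :=
  [set (X z, lab s (Y z - a)) | z in [set z | win s (Y z - a)]].

Lemma ptiling_tiling s a : good s -> is_tiling (ptiling s a).
Proof.
move=> gs x; have [z [zW z0 z1]] := tile_exists C len_gt0 a x s.
exists (X z, lab s (Y z - a)); split.
  by split; [exists z|rewrite /= tl_lab// z0 z1].
move=> _ [[z' z'W <-]] /=; rewrite tl_lab// => h.
by rewrite (@tile_uniq _ _ C _ len_gt0 a x s z z')// z0.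
Qed.

Lemma ptiling_vertices s a :
  vertices (ptiling s a) = [set X z | z in [set z | win s (Y z - a)]].
Proof. by rewrite /vertices /ptiling image_comp. Qed.

(** The height of [M z] above [mu * a - delta] is [mu * (Y z - a) + delta]. Conversely a vertex of
    the new tiling lies in the inflation of a tile of the old one and is reached by the walk through
    it. *)
Lemma subst_ptiling s a : good s ->
  subst (ptiling s a) = ptiling (side s) (mu * a - delta).
Proof.
have E z : Y (M z) - (mu * a - delta) = mu * (Y z - a) + delta.
  by rewrite YM; ring.
move=> gs; apply/seteqP; split => [_ [_ [i [[z /= zW <-] /= im ->]]]|_ [z' /= z'W <-]].
  move: im; rewrite repl_labE// size_map size_iota => im.
  exists (M z + subwalk s (Y z - a) i).
    by rewrite /= raddfD addrAC E; exact: subwalk_win.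
  rewrite sum_sublab//; last exact: ltnW.
  by rewrite raddfD XM raddfD addrAC E (nth_map 0%N) ?size_iota// nth_iota.
have [z [zW z0 z1]] := tile_exists C len_gt0 a (X z' / lam) s.
rewrite ler_pdivlMr// mulrC in z0.
rewrite ltr_pdivrMr// mulrDl ![_ * lam]mulrC in z1.
have [||i wi] := @walkP _ _ C _ len_gt0 _ _ (z' - M z) (img_win gs zW).
- suff -> : mu * (Y z - a) + delta + Y (z' - M z) = Y z' - (mu * a - delta) by [].
  by rewrite raddfB YM; ring.
- by rewrite raddfB XM subr_ge0.
rewrite -/(subwalk _ _ _) in wi.
have hn : X (subwalk s (Y z - a) (nsub s (Y z - a))) = lam * X (nstep s (Y z - a)).
  by rewrite nsubP// XM.
have hi : X (subwalk s (Y z - a) i) = X z' - lam * X z by rewrite wi raddfB XM.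
have im : (i < nsub s (Y z - a))%N.
  rewrite ltnNge; apply/negP; rewrite leq_eqVlt => /orP[/eqP mi|/(subwalk_lt gs zW)].
    by move: hi; rewrite -mi hn; lra.
  by rewrite hi hn; lra.
exists (X z, lab s (Y z - a)), i => /=; split; first by exists z.
  by rewrite repl_labE// size_map size_iota.
rewrite repl_labE// sum_sublab; [|by []|by []|exact: ltnW].
rewrite hi (nth_map 0%N) ?size_iota// nth_iota// add0n wi.
by congr (_, lab _ _); [rewrite /=; ring|rewrite [Y (z' - _)]raddfB YM; ring].
Qed.

Lemma ptiling_translate s a k :
  ptiling s (a + Y k) = translate (X k) (ptiling s a).
Proof.
apply/seteqP; split => [_ [z /= zW <-]|_ [_ [z /= zW <-] <-]] /=.
  have e : Y (z - k) - a = Y z - (a + Y k) by rewrite raddfB; ring.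
  exists (X (z - k), lab s (Y (z - k) - a)); last by rewrite e raddfB subrK.
  by exists (z - k) => //=; rewrite e.
have e : Y (z + k) - (a + Y k) = Y z - a by rewrite raddfD; ring.
by exists (z + k); rewrite /= e// raddfD.
Qed.

(* A half-open piece of the window contains a one-sided neighbourhood of each of
   its points. *)
Lemma bits_shift s y p : mode = None -> exists2 e, 0 < e &
  forall t, 0 < t < e -> forall s2,
    bits s2 (y + (if s then t else - t)) p = bits s y p.
Proof.
move=> m; rewrite /bits m; suff [e e0 h] : exists2 e, 0 < e &
    forall t, 0 < t < e -> forall s2,
      lep s2 p (y + (if s then t else - t)) = lep s p y.
  by exists e => // t te s2; rewrite h.
have lt_lep s2 z : p < z -> lep s2 p z = true by case: s2 => //= /ltW.
have gt_lep s2 z : z < p -> lep s2 p z = false.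
  by case: s2 => /= h; apply/negbTE; rewrite -?ltNge// -leNgt ltW.
case: s => /=.
  have [py|py] := leP p y.
    by exists 1 => // t /andP[t0 _] s2; apply: lt_lep; lra.
  by exists (p - y) => [|t te s2]; [rewrite subr_gt0|apply: gt_lep; lra].
have [py|py] := ltP p y.
  by exists (y - p) => [|t te s2]; [rewrite subr_gt0|apply: lt_lep; lra].
by exists 1 => // t /andP[t0 _] s2; apply: gt_lep; lra.
Qed.

(** The move goes into the half-open piece of [y] and ends off all cuts, which is why the kind [s2]
    of the target window is arbitrary. *)
Lemma lab_shift s y : mode = None -> win s y -> exists2 e, 0 < e &
  forall t, 0 < t < e -> forall s2,
    let y' := y + (if s then t else - t) in win s2 y' /\ lab s2 y' = lab s y.
Proof.
move=> m yW.
have [||e e0 he] := @finite_radius R G [set z : G | z \in cutset]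
    (fun z t => forall s2, bits s2 (y + (if s then t else - t)) (cut z) = bits s y (cut z)).
- exact: finite_seq.
- by move=> z _; have [e e0 h] := bits_shift s y (cut z) m; exists e.
have [e1 e10 he1] := bits_shift s y 0 m.
have [e2 e20 he2] := bits_shift s y len m.
exists (Num.min e (Num.min e1 e2)); first by rewrite !lt_min e0 e10.
move=> t; rewrite !lt_min => /and4P[t0 t1 t2 t3] s2 /=; split.
  have g b : good b by rewrite /good m.
  rewrite winE (bits_lep (g s2) (g s) (he1 _ _ _)) ?t0//.
  by rewrite (bits_lep (g s2) (g s) (he2 _ _ _)) ?t0// -winE.
by apply/ffunP => -[z zc]; rewrite !ffunE he//= t0.
Qed.

(** Translation by a lattice vector moves the window by its height; density supplies one that
    approximates [a2 - a1] from the side prescribed by [s1]. *)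
Lemma ptiling_occur s1 a1 s2 a2 : mode = None ->
  patches_occur (ptiling s1 a1) (ptiling s2 a2).
Proof.
move=> m P Pfin PT.
have [||e e0 he] := @finite_radius R _ P
    (fun u t => exists z, u.1 = X z /\ forall s,
      let y' := Y z - a1 + (if s1 then t else - t) in win s y' /\ lab s y' = u.2).
- exact: Pfin.
- move=> u /PT[z /= zW <-]; have [e e0 h] := lab_shift m zW.
  by exists e => // t te; exists z; split=> // s; apply: h.
have [k [t te kt]] : exists k, exists2 t, 0 < t < e & Y k = a2 - a1 + (if s1 then t else - t).
  case: s1 {he PT} => /=.
    have [k hk] : exists k, a2 - a1 < Y k < a2 - a1 + e by apply: py_dense; rewrite ltrDl.
    by exists k; exists (Y k - (a2 - a1)); [lra|rewrite subrKC].
  have [k hk] : exists k, a2 - a1 - e < Y k < a2 - a1 by apply: py_dense; rewrite gtrBl.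
  by exists k; exists (a2 - a1 - Y k); [lra|rewrite opprB subrKC].
exists (X k) => _ [u Pu <-]; have [z [uz /(_ s2)[zW zl]]] := he u t Pu te.
have E : Y (z + k) - a2 = Y z - a1 + (if s1 then t else - t) by rewrite raddfD kt; ring.
by exists (z + k); rewrite /= E// zl raddfD uz.
Qed.

Lemma translate_occur (T : set (R * label rule)) c : patches_occur T (translate c T).
Proof. by move=> P _ PT; exists c => _ [u /PT Tu <-]; exists u. Qed.

Lemma ptiling_loc_iso s1 a1 s2 a2 : good s1 -> good s2 ->
  mode = None \/ (exists k, a2 = a1 + Y k) ->
  loc_iso (ptiling s1 a1) (ptiling s2 a2).
Proof.
move=> g1 g2 [m|[k ->]]; first by split; exact: ptiling_occur.
case m : mode g1 g2 => [s0|]; last by split; exact: ptiling_occur.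
rewrite /good m => /eqP-> /eqP->; split.
  by rewrite ptiling_translate; exact: translate_occur.
have := @translate_occur (ptiling s0 (a1 + Y k)) (X (- k)).
by rewrite -ptiling_translate [Y (- k)]raddfN addrK.
Qed.

(** Predecessors come from solving [mu * a' - delta = a], and their kind from [side] being an
    involution. With a fixed kind, [mu * a - delta = a + Y k] makes every predecessor a lattice
    translate. *)
Lemma ptiling_subst_tiling s a : good s ->
  mode = None \/ (exists k, mu * a - delta = a + Y k) ->
  is_subst_tiling (ptiling s a).
Proof.
move=> gs h; split=> [|n]; first exact: ptiling_tiling.
have [s' [a' [gs' ha' E]]] : exists s' a', [/\ good s',
    mode = None \/ (exists k, a' = a + Y k) &
    iter n (@subst R rule) (ptiling s' a') = ptiling s a].
  elim: n => [|n [s' [a' [gs' ha' <-]]]].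
    by exists s, a; split=> //; right; exists 0; rewrite raddf0 addr0.
  exists (side s'), ((a' + delta) / mu); split; first exact: good_side.
    case: ha' => [?|[k ->]]; first by left.
    case: h => [?|[k' hk']]; first by left.
    right; exists (M' (k - k')); apply: (mulfI mu_neq0).
    rewrite mulrDr -YM MK mulrC divfK// raddfB.
    have -> : delta = mu * a - a - Y k' by rewrite -addrA -opprD -hk' subKr.
    by ring.
  rewrite iterSr subst_ptiling ?good_side// sideK [mu * _]mulrC divfK//.
  by rewrite addrK.
exists (ptiling s' a'); split=> //; first exact: ptiling_tiling.
by apply: ptiling_loc_iso.
Qed.

Lemma exists_rule s a : good s ->
  mode = None \/ (exists k, mu * a - delta = a + Y k) ->
  exists (r : subst_rule R) (T : set (R * label r)),
    [/\ inflation r = lam, is_subst_tiling T, is_tiling (subst T), loc_iso T (subst T) &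
      vertices T = [set X z | z in [set z | win s (Y z - a)]] /\
      vertices (subst T) =
        [set X z | z in [set z | win (side s) (Y z - (mu * a - delta))]]].
Proof.
move=> gs h; exists rule, (ptiling s a); rewrite subst_ptiling// !ptiling_vertices.
split=> //; first exact: ptiling_subst_tiling.
  by apply: ptiling_tiling; exact: good_side.
by apply: ptiling_loc_iso => //; exact: good_side.
Qed.

End Rule.

(** * Coordinates of integer vectors *)

Section Plane.
Variable R : realType.

Lemma mul_mx_col2 (K : pzSemiRingType) (A : 'M[K]_2) (u : 'cV[K]_2) i :
  (A *m u) i 0 = A i 0 * u 0 0 + A i 1 * u 1 0.
Proof.
rewrite mxE !big_ord_recl big_ord0 addr0; congr (_ + _ * _); congr (_ _ _);
exact/val_inj.
Qed.

Lemma col2P (K : Type) (u u' : 'cV[K]_2) : u 0 0 = u' 0 0 -> u 1 0 = u' 1 0 -> u = u'.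
Proof.
move=> h0 h1; apply/colP => i; case: (unliftP 0 i) => [j|] -> //.
by have -> : lift 0 j = 1 by rewrite (ord1 j); apply/val_inj.
Qed.

Lemma zvecM (A : 'M[int]_2) z : zvec R (A *m z) = zmat R A *m zvec R z.
Proof. exact: map_mxM. Qed.

Lemma zvecB z z' : zvec R (z - z') = zvec R z - zvec R z'.
Proof. by apply/matrixP => i j; rewrite !mxE intrB. Qed.

Lemma pcoordD (u t z z' : 'cV[R]_2) : pcoord u t (z + z') = pcoord u t z + pcoord u t z'.
Proof. by rewrite /pcoord -mulrDl; congr (_ / _); rewrite /det2 !mxE; ring. Qed.

Lemma pcoordZ (u t z : 'cV[R]_2) c : pcoord u t (c *: z) = c * pcoord u t z.
Proof. by rewrite /pcoord mulrA; congr (_ / _); rewrite /det2 !mxE; ring. Qed.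

Lemma pcoordB (u t z z' : 'cV[R]_2) : pcoord u t (z - z') = pcoord u t z - pcoord u t z'.
Proof. by rewrite -scaleN1r pcoordD pcoordZ mulN1r. Qed.

Lemma pcoord_id (u t : 'cV[R]_2) : det2 u t != 0 -> pcoord u t u = 1.
Proof. exact: divff. Qed.

Lemma pcoord_ker (u t : 'cV[R]_2) : pcoord u t t = 0.
Proof. by rewrite /pcoord /det2 [t 0 0 * _]mulrC subrr mul0r. Qed.

Lemma det2_yvec (v : 'cV[R]_2) : det2 (yvec R) v = - v 0 0.
Proof. by rewrite /det2 !mxE /= mul0r mul1r sub0r. Qed.

Lemma PiYE (v u : 'cV[R]_2) : v 0 0 != 0 -> PiY v u = u 1 0 - u 0 0 * (v 1 0 / v 0 0).
Proof. by rewrite /PiY /pcoord det2_yvec /det2 => v0; field. Qed.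

(* The action of a matrix with eigenvector [v] on the quotient of the plane
   by the line spanned by [v]. *)
Lemma PiY_mulmx (A : 'M[R]_2) (v z : 'cV[R]_2) a : v 0 0 != 0 -> A *m v = a *: v ->
  PiY v (A *m z) = PiY v (A *m yvec R) * PiY v z.
Proof.
move=> v0 Av; have d0 : det2 (yvec R) v != 0 by rewrite det2_yvec oppr_eq0.
have [x {1}->] := pcoordP z d0; rewrite mulmxDr -!scalemxAr Av /PiY.
by rewrite pcoordD !pcoordZ pcoord_ker !mulr0 addr0 mulrC.
Qed.

Definition physc (v w : 'cV[R]_2) (z : 'cV[int]_2) : R := PiV v w (zvec R z).
Definition internal (v : 'cV[R]_2) (z : 'cV[int]_2) : R := PiY v (zvec R z).

Lemma physc_zmod_morphism v w : zmod_morphism (physc v w).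
Proof. by move=> z z'; rewrite /physc zvecB; exact: pcoordB. Qed.

HB.instance Definition _ v w :=
  GRing.isZmodMorphism.Build _ _ (physc v w) (physc_zmod_morphism v w).

Lemma internal_zmod_morphism v : zmod_morphism (internal v).
Proof. by move=> z z'; rewrite /internal zvecB; exact: pcoordB. Qed.

HB.instance Definition _ v :=
  GRing.isZmodMorphism.Build _ _ (internal v) (internal_zmod_morphism v).

(** Descent: [A *m z] satisfies the same equation, and its absolute entries are smaller where those
    of [z] are not zero. Applied to [M] and to its inverse, this shows that W and V contain no
    nonzero lattice point. *)
Lemma no_contracted_lattice_vector (A : 'M[int]_2) (c : R) z : c != 0 -> `|c| < 1 ->
  zvec R (A *m z) = c *: zvec R z -> z = 0.
Proof.
move=> c0 c1 Az; suff h i : z i 0 = 0 by apply/colP => i; rewrite h mxE.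
move: {2}(absz _) (leqnn (absz (z i 0))) => n.
elim: n z Az => [|n IH] z Az zn; first by move: zn; rewrite leqn0 absz_eq0 => /eqP.
have [//|zi] := eqVneq (z i 0) 0.
have Ai : ((A *m z) i 0)%:~R = c * (z i 0)%:~R :> R.
  by have /matrixP/(_ i 0) := Az; rewrite !mxE => ->.
have : (A *m z) i 0 = 0.
  apply: IH; first by rewrite zvecM [in LHS]Az -scalemxAr zvecM.
  rewrite -ltnS; apply: leq_trans zn.
  rewrite -ltz_nat !abszE -(ltr_int R) !intr_norm Ai normrM.
  by rewrite gtr_pMl// normr_gt0 intr_eq0.
move=> h; move: Ai; rewrite h => /esym/eqP; rewrite mulf_eq0 (negPf c0) intr_eq0.
by rewrite (negPf zi).
Qed.

Section Scheme.
Variables (v w : 'cV[R]_2) (M : 'M[int]_2) (lam mu : R).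
Hypothesis v0 : v 0 0 != 0.
Hypothesis w0 : w 0 0 != 0.
Hypothesis vw : det2 v w != 0.
Hypothesis M_unit : M \in unitmx.
Hypothesis lam_gt1 : 1 < lam.
Hypothesis Mv : zmat R M *m v = lam *: v.
Hypothesis mu_lt1 : `|mu| < 1.
Hypothesis Mw : zmat R M *m w = mu *: w.

Lemma zmatK (z : 'cV[R]_2) : zmat R (invmx M) *m (zmat R M *m z) = z.
Proof. by rewrite mulmxA -map_mxM mulVmx// map_mx1 mul1mx. Qed.

Lemma mu_neq0 : mu != 0.
Proof.
apply/eqP => m0; have := zmatK w; rewrite Mw m0 scale0r mulmx0 => /colP/(_ 0)/esym.
by rewrite !mxE => /eqP; rewrite (negPf w0).
Qed.

Lemma PiY_w : PiY v w != 0.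
Proof.
have e : det2 w v = - det2 v w by rewrite /det2; ring.
by rewrite /PiY /pcoord det2_yvec e mulf_neq0 ?invr_neq0 ?oppr_eq0.
Qed.

Lemma physcM z : physc v w (M *m z) = lam * physc v w z.
Proof.
rewrite /physc /PiV zvecM; have [y {1}->] := pcoordP (zvec R z) vw.
rewrite mulmxDr -!scalemxAr Mv Mw pcoordD !pcoordZ pcoord_ker pcoord_id//.
by rewrite !mulr0 addr0 mulr1 mulrC.
Qed.

Lemma PiYM_mulr z : PiY v (zmat R M *m z) = mu * PiY v z.
Proof.
suff e : PiY v (zmat R M *m yvec R) = mu by rewrite (PiY_mulmx _ v0 Mv) e.
apply: (mulIf PiY_w); rewrite -(PiY_mulmx _ v0 Mv) Mw; exact: pcoordZ.
Qed.

Lemma internalM z : internal v (M *m z) = mu * internal v z.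
Proof. by rewrite /internal zvecM PiYM_mulr. Qed.

Lemma physc_inj : injective (physc v w).
Proof.
apply: raddf_inj => z z0; have zX : pcoord v w (zvec R z) = 0 := z0.
have [y zE] := pcoordP (zvec R z) vw; move: zE; rewrite zX scale0r add0r => zE.
apply: (no_contracted_lattice_vector mu_neq0 mu_lt1 (A := M)).
by rewrite zvecM zE -scalemxAr Mw scalerA mulrC -scalerA.
Qed.

Lemma internal_inj : injective (internal v).
Proof.
apply: raddf_inj => z z0; have zX : pcoord (yvec R) v (zvec R z) = 0 := z0.
have d0 : det2 (yvec R) v != 0 by rewrite det2_yvec oppr_eq0.
have [y zE] := pcoordP (zvec R z) d0; move: zE; rewrite zX scale0r add0r => zE.
have lam_gt0 := lt_trans ltr01 lam_gt1.
apply: (@no_contracted_lattice_vector (invmx M) lam^-1).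
- by rewrite invr_neq0// gt_eqF.
- by rewrite gtr0_norm ?invr_gt0// invf_lt1.
have iv : zmat R (invmx M) *m v = lam^-1 *: v.
  by rewrite -[in RHS](zmatK v) Mv -[in RHS]scalemxAr scalerA mulVf ?gt_eqF// scale1r.
by rewrite zvecM zE -scalemxAr iv !scalerA mulrC.
Qed.

Lemma zvec_coords z i : zvec R z i 0 =
  physc v w z * v i 0 + internal v z / PiY v w * w i 0.
Proof.
have [y zE] := pcoordP (zvec R z) vw.
have zY : internal v z = y * PiY v w.
  by rewrite /internal zE /PiY pcoordD !pcoordZ pcoord_ker mulr0 add0r.
rewrite [LHS](congr1 (fun u : 'cV[R]_2 => u i 0) zE) !mxE zY mulfK//.
exact: PiY_w.
Qed.

Lemma finite_strip (K : R) :
  finite_set [set z | `|physc v w z| <= K /\ `|internal v z| <= K].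
Proof.
pose bound := Num.max 0 (\sum_(i < 2) (K * `|v i 0| + K / `|PiY v w| * `|w i 0|)).
have b0 : 0 <= bound by rewrite le_max lexx.
pose b := Num.bound bound; pose r := [seq n%:Z - b%:Z | n <- iota 0 (2 * b)].
pose f (u : int * int) : 'cV[int]_2 := \col_i (if i == 0 then u.1 else u.2).
apply: (@sub_finite_set _ _ (f @` ([set` r] `*` [set` r]))); last first.
  by apply: finite_image; apply: finite_setX; exact: finite_seq.
move=> z /= [zX zY].
have zr i : z i 0 \in r.
  have zi : `|z i 0| < b%:Z.
    rewrite -(ltr_int R) intr_norm; apply: le_lt_trans (archi_boundP b0).
    rewrite le_max; apply/orP; right; have := zvec_coords z i; rewrite mxE => ->.
    have K0 : 0 <= K by apply: le_trans zX.
    rewrite (bigD1 i)//= -[leLHS]addr0 lerD ?sumr_ge0//.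
      rewrite (le_trans (ler_normD _ _))// (normrM (physc v w z)).
      rewrite (normrM (_ / _)) (normrM (internal v z)) normfV.
      apply: lerD; first exact: ler_wpM2r.
      by apply: ler_wpM2r => //; apply: ler_wpM2r; rewrite ?invr_ge0.
    by move=> j _; rewrite addr_ge0// !mulr_ge0// invr_ge0.
  apply/mapP; exists (absz (z i 0 + b%:Z)); rewrite ?mem_iota; lia.
by exists (z 0 0, z 1 0); [split; exact: zr|apply: col2P; rewrite mxE].
Qed.

Definition e1 : 'cV[int]_2 := delta_mx 1 0.

Lemma internal_e1 : internal v e1 = 1.
Proof.
have -> : internal v e1 = PiY v (yvec R).
  by rewrite /internal /zvec /e1 map_delta_mx.
by rewrite /PiY pcoord_id// det2_yvec oppr_eq0.
Qed.

Lemma contract_exists (c e : R) : 0 < e -> exists n, `|c| * (mu ^+ 2) ^+ n < e.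
Proof.
move=> e0; have mu2 : `|mu ^+ 2| < 1 by rewrite normrX expr_lt1.
have /cvgrPdist_lt/(_ (e / (`|c| + 1))) := cvg_expr mu2.
rewrite divr_gt0 ?ltr_wpDl// => /(_ isT) [n _ /(_ n (leqnn n))] /=.
have m2 : 0 <= (mu ^+ 2) ^+ n by apply: exprn_ge0; exact: sqr_ge0.
rewrite sub0r normrN ger0_norm// ltr_pdivlMr ?ltr_wpDl// => h.
by exists n; apply: le_lt_trans h; rewrite mulrC ler_wpM2l// lerDl.
Qed.

Lemma physc_expM n z : physc v w (M ^+ n *m z) = lam ^+ n * physc v w z.
Proof.
elim: n => [|n IH]; first by rewrite !expr0 mul1mx mul1r.
by rewrite !exprS -mulrA -IH -physcM mulmxA.
Qed.

Lemma internal_expM n z : internal v (M ^+ n *m z) = mu ^+ n * internal v z.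
Proof.
elim: n => [|n IH]; first by rewrite !expr0 mul1mx mul1r.
by rewrite !exprS -mulrA -IH -internalM mulmxA.
Qed.

Lemma exists_quadrant (b : bool) : exists q,
  0 < physc v w q /\ 0 < (if b then internal v q else - internal v q).
Proof.
have lam_gt0 := lt_trans ltr01 lam_gt1.
have [u [u0 uX uY]] : exists u, [/\ 0 < physc v w u,
    physc v w u = `|physc v w e1| & `|internal v u| = 1].
  have : physc v w e1 != 0.
    rewrite -(raddf0 (physc v w)) (inj_eq physc_inj); apply/eqP => e0.
    by have := internal_e1; rewrite e0 raddf0 => /esym/eqP; rewrite oner_eq0.
  rewrite neq_lt => /orP[h|h]; [exists (- e1)|exists e1].
    by rewrite !raddfN oppr_gt0 /= normrN internal_e1 normr1 ltr0_norm.
  by rewrite internal_e1 normr1 gtr0_norm.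
(* Two inverse steps make [p] shorter than [u] along V but higher than [u]. So [u + p] and [u - p]
   take their direction along V from [u] and the sign of their height from [p] and [- p]. *)
pose p := invmx M *m (invmx M *m e1).
have pE : M *m (M *m p) = e1 by rewrite !mulKVmx.
have pX : `|physc v w p| < physc v w u.
  have e : physc v w e1 = lam ^+ 2 * physc v w p by rewrite -pE !physcM; ring.
  rewrite uX e (normrM (lam ^+ 2)) ger0_norm ?exprn_ge0 ?ltW// ltr_pMl ?exprn_egt1//.
  by rewrite normr_gt0; apply: contraL u0 => /eqP p0; rewrite uX e p0 mulr0 normr0 ltxx.
have pY : 1 < internal v p.
  have pm : mu ^+ 2 * internal v p = 1 by rewrite -internal_e1 -pE !internalM; ring.
  have m2 : 0 < mu ^+ 2 by rewrite exprn_even_gt0// mu_neq0.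
  rewrite -(ltr_pM2l m2) pm mulr1 -(ger0_norm (ltW m2)) normrX.
  by rewrite expr_lt1.
move: pX; rewrite ltr_norml => pX.
have := lexx `|internal v u|; rewrite {2}uY ler_norml => uY'.
by case: b; [exists (u + p)|exists (u - p)]; rewrite ?raddfD ?raddfB /=; split; lra.
Qed.

Lemma exists_small b e : 0 < e -> exists q,
  0 < physc v w q /\ 0 < (if b then internal v q else - internal v q) < e.
Proof.
have lam_gt0 := lt_trans ltr01 lam_gt1.
move=> e_gt0; have [q [qX qY]] := exists_quadrant b.
have [n nE] := contract_exists (internal v q) e_gt0.
have m2 : 0 < (mu ^+ 2) ^+ n by rewrite exprn_gt0// exprn_even_gt0// mu_neq0.
(* An even power shrinks the height without changing its sign. *)
exists (M ^+ (2 * n) *m q); rewrite physc_expM internal_expM mulr_gt0 ?exprn_gt0//.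
split=> //; set y := if b then internal v q else - internal v q in qY.
have -> : (if b then mu ^+ (2 * n) * internal v q else - (mu ^+ (2 * n) * internal v q)) =
    (mu ^+ 2) ^+ n * y by rewrite exprM /y; case: (b) => //; rewrite mulrN.
rewrite mulr_gt0//= (le_lt_trans _ nE)// mulrC ler_wpM2r ?(ltW m2)//.
have := ler_norm (internal v q); have := ler_norm (- internal v q).
by rewrite /y normrN; case: (b).
Qed.

(** Kept transparent, so that its [px] and [py] convert to [physc v w] and [internal v]. *)
Definition lattice_cutproj : cutproj R 'cV[int]_2.
Proof.
refine (@CutProj _ _ (physc v w) (internal v) physc_inj internal_inj finite_strip _ _).
  by move=> e /(exists_small true)[q h]; exists q.
by move=> e /(exists_small false)[q [h h']]; exists q; split=> //; lra.
Defined.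

End Scheme.
End Plane.

(** * Quadratic fields *)

Section Quadratic.
Variables (R : realType) (s : R).
Hypothesis irr : forall a b : rat, ratr a + ratr b * s = 0 -> a = 0 /\ b = 0.
Variables t d : rat.
Hypothesis quad : s * s = ratr t * s + ratr d.
Notation K := (Qadj s).

Lemma Qadj_rat (a : rat) : K (ratr a).
Proof. by exists a, 0; rewrite raddf0 mul0r addr0. Qed.

Lemma QadjD x y : K x -> K y -> K (x + y).
Proof. by move=> [a [b ->]] [a' [b' ->]]; exists (a + a'), (b + b'); rewrite !rmorphD /=;
  ring. Qed.

Lemma QadjN x : K x -> K (- x).
Proof. by move=> [a [b ->]]; exists (- a), (- b); rewrite !rmorphN /=; ring. Qed.

Lemma QadjB x y : K x -> K y -> K (x - y).
Proof. by move=> hx hy; apply: QadjD => //; exact: QadjN. Qed.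

Lemma QadjM x y : K x -> K y -> K (x * y).
Proof.
move=> [a [b ->]] [a' [b' ->]].
exists (a * a' + b * b' * d), (a * b' + a' * b + b * b' * t).
rewrite !rmorphD !rmorphM /=.
transitivity (ratr a * ratr a' + (ratr a * ratr b' + ratr a' * ratr b) * s
  + ratr b * ratr b' * (s * s)); first by ring.
by rewrite quad; ring.
Qed.

Lemma QadjV x : K x -> K x^-1.
Proof.
move=> [a [b xE]]; have [->|x0] := eqVneq x 0; first by rewrite invr0 -(rmorph0 ratr);
  exact: Qadj_rat.
(* Norm and conjugate of [x]: the other root of the equation of [s] is [ratr t - s]. *)
pose n := a ^+ 2 + a * b * t - b ^+ 2 * d.
pose y := ratr (a + b * t) + ratr (- b) * s.
have xy : x * y = ratr n.
  rewrite xE /y /n !(rmorphD, rmorphN, rmorphM, rmorphXn) /=.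
  transitivity (ratr a ^+ 2 + ratr a * ratr b * ratr t + ratr b ^+ 2 * (ratr t * s)
     - ratr b ^+ 2 * (s * s)); first by ring.
  by rewrite quad; ring.
have y0 : y != 0.
  apply: contra_neq x0 => /irr[ab /eqP]; rewrite oppr_eq0 => /eqP b0.
  by move: ab; rewrite b0 mul0r addr0 => a0; rewrite xE a0 b0 !raddf0 mul0r addr0.
have -> : x^-1 = y * ratr n^-1.
  by rewrite (fmorphV ratr n) /= -xy invfM mulrCA divff ?mulr1.
by apply: QadjM; [exists (a + b * t), (- b)|exact: Qadj_rat].
Qed.

Lemma Qadj_exp x n : K x -> K (x ^+ n).
Proof.
move=> hx; elim: n => [|n IH]; last by rewrite exprS; exact: QadjM.
by rewrite expr0 -(rmorph1 ratr); exact: Qadj_rat.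
Qed.

(* The relations [b i = nu * b j + k] with [k] in a field [K] have a cycle, on
   which [b] is the fixed point of a contraction defined over [K]. *)
Lemma Qadj_finite_recursion (I : finType) (P : pred I) (b : I -> R) (nu : R) :
  K nu -> nu != 0 -> `|nu| < 1 ->
  (forall i, P i -> exists2 j, P j & K (b i - nu * b j)) ->
  forall i, P i -> K (b i).
Proof.
move=> Knu nu0 nu1 h i0 Pi0.
have /choice[f hf] : forall i, exists j, P i -> P j /\ K (b i - nu * b j).
  by move=> i; have [Pi|_] := boolP (P i); [have [j] := h i Pi; exists j|exists i].
have Pf n : P (iter n f i0) by elim: n => //= n /hf[].
have step n m : K (b (iter n f i0) - nu ^+ m * b (iter (m + n) f i0)).
  elim: m => [|m IH]; first by rewrite mul1r subrr -(rmorph0 ratr); exact: Qadj_rat.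
  have [_ /(QadjM (Qadj_exp m Knu)) h'] := hf _ (Pf (m + n)%N).
  by have := QadjD IH h'; rewrite addSn iterS exprSr; congr (Qadj s _); ring.
have /injectivePn[m [n mn]] : ~~ injectiveb (fun n : 'I_#|I|.+1 => iter n f i0).
  by apply/negP => /injectiveP/leq_card; rewrite card_ord ltnn.
wlog lt_mn : m n mn / (m < n)%N => [hw e|e].
  by case: (ltngtP m n) => // [/hw|/hw|/val_inj me];
    [exact|apply; rewrite 1?eq_sym|rewrite me eqxx in mn].
have Kc : K (b (iter m f i0)).
  have := step m (n - m)%N; rewrite subnK 1?ltnW// -e -[X in X - _]mul1r -mulrBl.
  have c0 : 1 - nu ^+ (n - m) != 0.
    rewrite subr_eq0 eq_sym; apply/eqP => /(congr1 Num.norm)/eqP.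
    by rewrite normrX normr1 lt_eqF// expr_lt1// subn_gt0.
  move=> /(QadjM (QadjV (QadjB (Qadj_rat 1) (Qadj_exp (n - m) Knu)))).
  by rewrite rmorph1 mulKf.
have := QadjD (step 0%N m) (QadjM (Qadj_exp m Knu) Kc).
by rewrite addn0 subrK.
Qed.

End Quadratic.

(** * The quadratic field generated by the slope of V *)

Section Slope.
Variables (R : realType) (v : 'cV[R]_2).
Hypothesis v0 : v 0 0 != 0.
Hypothesis Y_inj : injective (internal v).
Notation s := (v 1 0 / v 0 0).
Notation Y := (internal v).

Lemma internalE z : Y z = (z 1 0)%:~R - (z 0 0)%:~R * s.
Proof. by rewrite /internal PiYE// !mxE. Qed.

Lemma clear_denominators (a b : rat) : exists (n : nat) (p q : int),
  [/\ (0 < n)%N, a = p%:~R / n%:R & b = q%:~R / n%:R].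
Proof.
exists (absz (denq a * denq b)), (numq a * denq b), (numq b * denq a).
have d0 (c : rat) : (denq c)%:~R != 0 :> rat by rewrite intr_eq0 denq_neq0.
have nE : (absz (denq a * denq b))%:R = (denq a)%:~R * (denq b)%:~R :> rat.
  by rewrite -intrM pmulrn gtz0_abs// mulr_gt0.
split; first by rewrite absz_gt0 mulf_neq0// denq_neq0.
  by rewrite -[LHS]divq_num_den nE !intrM; field; rewrite !d0.
by rewrite -[LHS]divq_num_den nE !intrM; field; rewrite !d0.
Qed.

Lemma ratr_frac (p : int) (n : nat) : ratr (p%:~R / n%:R) = p%:~R / n%:R :> R.
Proof. by rewrite fmorph_div rmorph_int rmorph_nat. Qed.

(** Every number of the field is a height of the refined lattice [(1/n) Z^2]; this is how the length
    conditions become cuts. *)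
Lemma Qadj_internal_div x : Qadj s x -> exists (n : nat) z, (0 < n)%N /\ x = Y z / n%:R.
Proof.
move=> [a [b ->]]; have [n [p [q [n0 -> ->]]]] := clear_denominators a b.
exists n, (\col_i (if i == 0 then - q else p)); split=> //.
rewrite internalE !mxE /= !ratr_frac rmorphN /=.
by field; rewrite v0 pnatr_eq0 -lt0n n0.
Qed.

Lemma slope_irrational (a b : rat) : ratr a + ratr b * s = 0 -> a = 0 /\ b = 0.
Proof.
have [n [p [q [n0 -> ->]]]] := clear_denominators a b.
have nR0 : n%:R != 0 :> R by rewrite pnatr_eq0 -lt0n.
rewrite !ratr_frac => h.
have : Y (\col_i (if i == 0 then - q else p)) = Y 0.
  rewrite !internalE !mxE /= rmorphN /= mul0r subr0 mulNr opprK.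
  apply: (mulIf (invr_neq0 nR0)); rewrite mul0r -[RHS]h; ring.
move/Y_inj/matrixP => e; have := e 0 0; have := e 1 0; rewrite !mxE /=.
by move=> -> /eqP; rewrite oppr_eq0 => /eqP->; rewrite !mul0r.
Qed.

Lemma Qadj_internal z : Qadj s (Y z).
Proof.
exists (z 1 0)%:~R, (- (z 0 0)%:~R).
by rewrite internalE rmorphN !rmorph_int mulNr.
Qed.

Lemma eigen_slope (N : 'M[int]_2) (L : R) : zmat R N *m v = L *: v ->
  L = (N 0 0)%:~R + (N 0 1)%:~R * s /\
  (N 0 0)%:~R * s + (N 0 1)%:~R * (s * s) = (N 1 0)%:~R + (N 1 1)%:~R * s.
Proof.
move=> e; have e0 := congr1 (fun u : 'cV[R]_2 => u 0 0) e.
have e1 := congr1 (fun u : 'cV[R]_2 => u 1 0) e.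
move: e0 e1; rewrite /= !mul_mx_col2 !mxE => e0 e1.
have LE : L = (N 0 0)%:~R + (N 0 1)%:~R * s.
  by apply: (mulIf v0); rewrite -e0; field.
split=> //; apply: (mulIf v0).
transitivity (L * v 1 0); first by rewrite LE; field.
by rewrite -e1; field.
Qed.

(** If the entry vanished, the irrational slope would force equal diagonal entries, and the
    multiplier on heights would be [L]. *)
Lemma eigen_offdiag (N : 'M[int]_2) (L nu : R) : zmat R N *m v = L *: v ->
  (forall z, Y (N *m z) = nu * Y z) -> nu != L -> N 0 1 != 0.
Proof.
move=> /eigen_slope[LE sE] YN; apply: contraNneq => N01.
rewrite N01 mul0r addr0 in LE.
rewrite N01 mul0r addr0 in sE.
have [] := @slope_irrational ((N 1 0)%:~R) (N 1 1 - N 0 0)%:~R.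
  by rewrite !ratr_int intrB mulrBl addrA -sE subrr.
move=> _ /eqP; rewrite intr_eq0 subr_eq0 => /eqP N11.
have := YN (delta_mx 1 0);
  have -> : Y (delta_mx 1 0) = 1 by rewrite internalE !mxE /= mul0r subr0.
by rewrite mulr1 => <-;
  rewrite internalE !mul_mx_col2 !mxE /= N01 N11 !mulr0 !mulr1 !add0r mul0r subr0 LE.
Qed.

(** [L] is affine in the slope with nonzero coefficient [N 0 1], so each generates the other. *)
Lemma Qadj_eigen (N : 'M[int]_2) (L nu : R) : zmat R N *m v = L *: v ->
  (forall z, Y (N *m z) = nu * Y z) -> nu != L -> Qadj L = Qadj s.
Proof.
move=> NL YN nuL; have N01 := eigen_offdiag NL YN nuL; have [LE _] := eigen_slope NL.
have NR0 : (N 0 1)%:~R != 0 :> R by rewrite intr_eq0.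
have sE : s = (L - (N 0 0)%:~R) / (N 0 1)%:~R by rewrite LE; field; rewrite v0 NR0.
apply/seteqP; split => x [a [b ->]].
  exists (a + b * (N 0 0)%:~R), (b * (N 0 1)%:~R).
  by rewrite LE !rmorphD !rmorphM !rmorph_int /=; ring.
exists (a - b * (N 0 0)%:~R / (N 0 1)%:~R), (b / (N 0 1)%:~R).
rewrite sE !rmorphB !rmorphM !fmorphV !rmorph_int /=; field.
by rewrite NR0.
Qed.

Lemma slope_quadratic (N : 'M[int]_2) (L nu : R) : zmat R N *m v = L *: v ->
  (forall z, Y (N *m z) = nu * Y z) -> nu != L ->
  exists t d : rat, s * s = ratr t * s + ratr d.
Proof.
move=> NL YN nuL; have N01 := eigen_offdiag NL YN nuL; have [_ sE] := eigen_slope NL.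
have NR0 : (N 0 1)%:~R != 0 :> R by rewrite intr_eq0.
exists ((N 1 1 - N 0 0)%:~R / (N 0 1)%:~R), ((N 1 0)%:~R / (N 0 1)%:~R).
rewrite !rmorphM !fmorphV !rmorph_int /= intrB; apply: (mulfI NR0).
transitivity ((N 1 0)%:~R + (N 1 1)%:~R * s - (N 0 0)%:~R * s); first by rewrite -sE; ring.
by field; rewrite v0 NR0.
Qed.

End Slope.

(** * Windows and their gaps *)

Section Intervals.
Variable R : realType.
Implicit Types O U : window R.

Lemma wsetE O x : wset O x <-> win (wlen O) (wside O) (x - wlo O).
Proof.
rewrite /wset /wlen /win /= in_itv /=; case: (wside O) => /=; split; lra.
Qed.

Lemma wset_closure O x : wset O x -> wlo O <= x <= whi O.
Proof. by move=> /wsetE/win_bounds; rewrite /wlen; lra. Qed.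

Lemma wset_open O x : wlo O < x < whi O -> wset O x.
Proof. by move=> h; apply/wsetE/win_open; rewrite /wlen; lra. Qed.

Lemma wset_interval O : is_interval (wset O).
Proof. exact: interval_is_interval. Qed.

Lemma wlen_gt0 O : 0 < wlen O.
Proof. by rewrite /wlen subr_gt0 wlohi. Qed.

Lemma wset_mid O : wset O ((wlo O + whi O) / 2).
Proof. by have := wlohi O; move=> h; apply: wset_open; apply/andP; split; lra. Qed.

Lemma wset_sub_bounds U O : wset U `<=` wset O -> wlo O <= wlo U /\ whi U <= whi O.
Proof.
move=> UO; have h := wlohi U; split; rewrite leNgt; apply/negP => lt.
  pose x := (wlo U + Num.min (wlo O) (whi U)) / 2.
  have m : wlo U < Num.min (wlo O) (whi U) by rewrite lt_min lt h.
  have m1 : Num.min (wlo O) (whi U) <= wlo O by rewrite ge_min lexx.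
  have m2 : Num.min (wlo O) (whi U) <= whi U by rewrite ge_min lexx orbT.
  have /UO/wset_closure : wset U x by apply: wset_open; rewrite /x; apply/andP; split; lra.
  by rewrite /x; lra.
pose x := (whi U + Num.max (whi O) (wlo U)) / 2.
have m : Num.max (whi O) (wlo U) < whi U by rewrite gt_max lt h.
have m1 : whi O <= Num.max (whi O) (wlo U) by rewrite le_max lexx.
have m2 : wlo U <= Num.max (whi O) (wlo U) by rewrite le_max lexx orbT.
have /UO/wset_closure : wset U x by apply: wset_open; rewrite /x; apply/andP; split; lra.
by rewrite /x; lra.
Qed.

Lemma wset_lo O : wset O (wlo O) <-> wside O.
Proof.
have h := wlen_gt0 O.
by rewrite wsetE subrr /win; case: (wside O); rewrite ?ltxx ?lexx ?h.
Qed.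

Lemma wset_inj U O : wset U = wset O -> wside U = wside O /\ wlo U = wlo O.
Proof.
move=> e; have /wset_sub_bounds[l1 _] : wset U `<=` wset O by rewrite e.
have /wset_sub_bounds[l2 _] : wset O `<=` wset U by rewrite e.
have lo : wlo U = wlo O by apply/eqP; rewrite eq_le l1 l2.
by split=> //; apply/idP/idP; rewrite -!wset_lo e lo.
Qed.

Lemma scale_window O (c : R) : c != 0 -> exists U,
  [/\ wset U = [set c * y | y in wset O], wside U = wside O (+) (c < 0),
     wlo U = (if c < 0 then c * whi O else c * wlo O) &
     whi U = (if c < 0 then c * wlo O else c * whi O)].
Proof.
move=> c0; have lohi := wlohi O.
have h : (if c < 0 then c * whi O else c * wlo O) <
         (if c < 0 then c * wlo O else c * whi O).
  have [cn|cp] := ltP c 0; first by rewrite ltr_nM2l.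
  by rewrite ltr_pM2l// lt_neqAle eq_sym c0.
exists (@Window R (wside O (+) (c < 0)) _ _ h); split=> //.
apply/seteqP; split=> [x|_ [y yO <-]].
  rewrite -[x](mulVKf c0) => xU; exists (c^-1 * x) => //; move: (_ * x) xU => {}x.
  rewrite /wset /= !in_itv /=; have [cn|cp] := ltP c 0.
    by case: (wside O); rewrite /= ?(ltr_nM2l cn) ?(ler_nM2l cn) andbC.
  have {}cp : 0 < c by rewrite lt_neqAle eq_sym c0.
  by case: (wside O); rewrite /= ?(ltr_pM2l cp) ?(ler_pM2l cp).
move: yO; rewrite /wset /= !in_itv /=; have [cn|cp] := ltP c 0.
  by case: (wside O); rewrite /= ?(ltr_nM2l cn) ?(ler_nM2l cn) andbC.
have {}cp : 0 < c by rewrite lt_neqAle eq_sym c0.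
by case: (wside O); rewrite /= ?(ltr_pM2l cp) ?(ler_pM2l cp).
Qed.

Lemma shift_window O c : exists U,
  [/\ wset U = [set y + c | y in wset O], wside U = wside O & wlo U = wlo O + c].
Proof.
have h : wlo O + c < whi O + c by rewrite ltrD2r wlohi.
exists (@Window R (wside O) _ _ h); split=> //.
apply/seteqP; split=> [x|_ [y yO <-]].
  rewrite -[x](subrK c) => xU; exists (x - c) => //; move: (x - c) xU => {}x.
  by rewrite /wset /= !in_itv /=; case: (wside O); rewrite /= ?lerD2r ?ltrD2r.
by move: yO; rewrite /wset /= !in_itv /=; case: (wside O); rewrite /= ?lerD2r ?ltrD2r.
Qed.

Lemma ilen_between (A : set R) p q : A !=set0 ->
  (forall x, p < x < q -> A x) -> (forall x, A x -> p <= x <= q) -> ilen A = q - p.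
Proof.
move=> [a0 Aa0] Ain Aout.
have hs : has_sup A by split; [exists a0|exists q => x /Aout/andP[]].
have hi : has_inf A by split; [exists a0|exists p => x /Aout/andP[]].
have /andP[a1 a2] := Aout _ Aa0.
rewrite /ilen; congr (_ - _); apply/eqP; rewrite eq_le; apply/andP; split.
- by apply: ge_sup; [exists a0|move=> x /Aout/andP[]].
- rewrite leNgt; apply/negP => lt; have ub := ub_le_sup hs.2.
  have := ub _ Aa0 => as0; have /Ain/ub : p < (sup A + q) / 2 < q.
    by apply/andP; split; lra.
  by lra.
- rewrite leNgt; apply/negP => lt; have lb := ge_inf hi.2.
  have := lb _ Aa0 => as0; have /Ain/lb : p < (inf A + p) / 2 < q.
    by apply/andP; split; lra.
  by lra.
- by apply: lb_le_inf; [exists a0|move=> x /Aout/andP[]].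
Qed.

Section Gaps.
Variables U O : window R.
Hypothesis UO : wset U `<=` wset O.
Notation gap := (wset O `\` wset U).

(** A connected subset of the gap cannot pass the midpoint of [U], and the part of [O] below [U] is
    itself an interval. *)
Lemma gap_below y : gap y -> y < (wlo U + whi U) / 2 ->
  connected_component gap y = [set x | wset O x /\ forall u, wset U u -> x < u].
Proof.
move=> [yO yU] ymid; have Umid := wset_mid U; move: ymid Umid; set m := _ / 2 => ymid Um.
have below x : gap x -> x < m -> forall u, wset U u -> x < u.
  move=> [xO xU] xm u uU; rewrite ltNge; apply/negP => ux; apply: xU.
  by apply: (@wset_interval U u m) => //; rewrite ux ltW.
apply/seteqP; split=> x.
  move=> xc; have xg := connected_component_sub xc; split; first by case: xg.
  apply: below => //; rewrite ltNge; apply/negP => mx.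
  have /connected_intervalP ci := component_connected (A := gap) (x := y).
  have /connected_component_sub[] : connected_component gap y m.
    apply: (ci y x) => //; last by rewrite (ltW ymid) mx.
    exact: connected_component_refl.
  by move=> _; apply.
move=> [xO xb]; apply: (@connected_component_max _ gap
    [set x | wset O x /\ forall u, wset U u -> x < u]) => //.
- by split=> // u uU; exact: below.
- by move=> z [zO zb]; split=> // zU; have := zb _ zU; rewrite ltxx.
apply/connected_intervalP => p q [pO pb] [qO qb] z /andP[pz zq]; split.
  by apply: (@wset_interval O p q) => //; rewrite pz.
by move=> u uU; apply: le_lt_trans zq (qb _ uU).
Qed.

Lemma gap_above y : gap y -> (wlo U + whi U) / 2 < y ->
  connected_component gap y = [set x | wset O x /\ forall u, wset U u -> u < x].
Proof.
move=> [yO yU] ymid; have Umid := wset_mid U; move: ymid Umid; set m := _ / 2 => ymid Um.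
have above x : gap x -> m < x -> forall u, wset U u -> u < x.
  move=> [xO xU] xm u uU; rewrite ltNge; apply/negP => ux; apply: xU.
  by apply: (@wset_interval U m u) => //; rewrite ux ltW.
apply/seteqP; split=> x.
  move=> xc; have xg := connected_component_sub xc; split; first by case: xg.
  apply: above => //; rewrite ltNge; apply/negP => mx.
  have /connected_intervalP ci := component_connected (A := gap) (x := y).
  have /connected_component_sub[] : connected_component gap y m.
    apply: (ci x y) => //; last by rewrite (ltW ymid) mx.
    exact: connected_component_refl.
  by move=> _; apply.
move=> [xO xb]; apply: (@connected_component_max _ gap
    [set x | wset O x /\ forall u, wset U u -> u < x]) => //.
- by split=> // u uU; exact: above.
- by move=> z [zO zb]; split=> // zU; have := zb _ zU; rewrite ltxx.
apply/connected_intervalP => p q [pO pb] [qO qb] z /andP[pz zq]; split.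
  by apply: (@wset_interval O p q) => //; rewrite pz.
by move=> u uU; apply: lt_le_trans (pb _ uU) pz.
Qed.

Lemma ilen_gap_below y : gap y -> y < (wlo U + whi U) / 2 ->
  ilen (connected_component gap y) = wlo U - wlo O.
Proof.
move=> yg ym; have ycc := connected_component_refl yg.
have [lo hi] := wset_sub_bounds UO; have Ul := wlohi U.
move: ycc; rewrite (gap_below yg ym) => ycc.
apply: ilen_between => [|x xb|x [xO xb]]; first by exists y.
  split=> [|u /wset_closure ub]; last lra.
  by apply: wset_open; lra.
have /wset_closure := xO => xO'; suff : x <= wlo U by lra.
rewrite leNgt; apply/negP => xU.
pose z := (wlo U + Num.min x (whi U)) / 2.
have m : wlo U < Num.min x (whi U) by rewrite lt_min xU.
have m1 : Num.min x (whi U) <= x by rewrite ge_min lexx.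
have m2 : Num.min x (whi U) <= whi U by rewrite ge_min lexx orbT.
have /xb : wset U z by apply: wset_open; rewrite /z; apply/andP; split; lra.
by rewrite /z; lra.
Qed.

Lemma ilen_gap_above y : gap y -> (wlo U + whi U) / 2 < y ->
  ilen (connected_component gap y) = whi O - whi U.
Proof.
move=> yg ym; have ycc := connected_component_refl yg.
have [lo hi] := wset_sub_bounds UO; have Ul := wlohi U.
move: ycc; rewrite (gap_above yg ym) => ycc.
apply: ilen_between => [|x xb|x [xO xb]]; first by exists y.
  split=> [|u /wset_closure ub]; last lra.
  by apply: wset_open; lra.
have /wset_closure := xO => xO'; suff : whi U <= x by lra.
rewrite leNgt; apply/negP => xU.
pose z := (whi U + Num.max x (wlo U)) / 2.
have m : Num.max x (wlo U) < whi U by rewrite gt_max xU.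
have m1 : x <= Num.max x (wlo U) by rewrite le_max lexx.
have m2 : wlo U <= Num.max x (wlo U) by rewrite le_max lexx orbT.
have /xb : wset U z by apply: wset_open; rewrite /z; apply/andP; split; lra.
by rewrite /z; lra.
Qed.

Lemma ilen_gap y : gap y ->
  ilen (connected_component gap y) = wlo U - wlo O \/
  ilen (connected_component gap y) = whi O - whi U.
Proof.
move=> yg; case: (ltgtP y ((wlo U + whi U) / 2)) => ym.
- by left; exact: ilen_gap_below.
- by right; exact: ilen_gap_above.
by case: yg => _ []; rewrite ym; exact: wset_mid.
Qed.

(** Condition (iii) says nothing when there is no component below [U]; the lower ends then coincide
    and the distance is zero. *)
Lemma gap_below_exists : wlo O = wlo U \/ exists2 y, gap y &
  ilen (connected_component gap y) = wlo U - wlo O.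
Proof.
have [lo hi] := wset_sub_bounds UO; have Ul := wlohi U.
move: lo; rewrite le_eqVlt => /orP[/eqP lo|lo]; first by left.
right; exists ((wlo O + wlo U) / 2); last apply: ilen_gap_below.
- by split=> [|/wset_closure]; [apply: wset_open; apply/andP; split; lra|lra].
- by split=> [|/wset_closure]; [apply: wset_open; apply/andP; split; lra|lra].
- by lra.
Qed.

End Gaps.
End Intervals.

(** * Strips expressed by heights *)

Section Strips.
Variables (R : realType) (v w : 'cV[R]_2).
Hypothesis v0 : v 0 0 != 0.

Let d0 : det2 (yvec R) v != 0. Proof. by rewrite det2_yvec oppr_eq0. Qed.

Let PiY_yvec y : PiY v (y *: yvec R) = y.
Proof. by rewrite [LHS]pcoordZ pcoord_id// mulr1. Qed.

Lemma stripE (A : set R) z : strip v A z <-> A (PiY v z).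
Proof.
split=> [[x [y [yA ->]]]|zA];
  first by rewrite /PiY pcoordD !pcoordZ pcoord_ker mulr0 add0r pcoord_id// mulr1.
by have [x zE] := pcoordP z d0; exists x, (PiY v z); split=> //; rewrite addrC [LHS]zE.
Qed.

Lemma strip_latticeE (U : window R) z : strip_lattice v U z <-> wset U (internal v z).
Proof. exact: stripE. Qed.

Lemma proj_verticesE (U : window R) :
  proj_vertices v w U = [set physc v w z | z in [set z | wset U (internal v z)]].
Proof. by apply/seteqP; split=> _ [z /strip_latticeE zU <-]; exists z. Qed.

Variables (N : 'M[int]_2) (nu : R).
Hypothesis PiYN : forall z, PiY v (zmat R N *m z) = nu * PiY v z.

Lemma PiYM_E (A : set R) : PiYM v N A = [set nu * y | y in A].
Proof. by apply/seteqP; split=> _ [y yA <-]; exists y => //; rewrite PiYN PiY_yvec. Qed.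

Lemma strip_imageE (A A' : set R) :
  [set zmat R N *m z | z in strip v A] `<=` strip v A' <->
  [set nu * y | y in A] `<=` A'.
Proof.
split=> [h _ [y yA <-]|h _ [z /stripE zA <-]]; last by apply/stripE; rewrite PiYN; apply: h;
  exists (PiY v z).
rewrite -[y]PiY_yvec -PiYN; apply/stripE; apply: h; exists (y *: yvec R) => //.
by apply/stripE; rewrite PiY_yvec.
Qed.

End Strips.

(** * A substitution rule from an admissible window *)

Section Forward.
Variables (R : realType) (v w : 'cV[R]_2) (M : 'M[int]_2) (lam mu : R).
Hypothesis v0 : v 0 0 != 0.
Hypothesis w0 : w 0 0 != 0.
Hypothesis vw : det2 v w != 0.
Hypothesis M_unit : M \in unitmx.
Hypothesis lam_gt1 : 1 < lam.
Hypothesis Mv : zmat R M *m v = lam *: v.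
Hypothesis mu_lt1 : `|mu| < 1.
Hypothesis Mw : zmat R M *m w = mu *: w.
Variable O : window R.
Hypothesis O_len : Qadj lam (wlen O).

Notation X := (physc v w).
Notation Y := (internal v).

(** Both sides have coordinate [lam * X d] along V, and this coordinate is injective on the
    lattice. *)
Lemma associated_matrix_of_inflation (s : subst_rule R) T :
  inflation s = lam -> @associated_matrix R s v w O T M.
Proof.
move=> sl T' _ _ _ t d u u' T't _ td _ uE _ u'E.
apply: (physc_inj w0 vw M_unit mu_lt1 Mw).
transitivity (X u' - X u); first exact: raddfB.
by rewrite (physcM vw Mv Mw) -[X d]td [X u']u'E [X u]uE sl; ring.
Qed.

Let C := lattice_cutproj v0 w0 vw M_unit lam_gt1 Mv mu_lt1 Mw.
Let mu0 : mu != 0 := mu_neq0 w0 M_unit Mw.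

Let mu_neq_lam : mu != lam.
Proof.
by apply/eqP => e; have := ler_norm mu; move: mu_lt1 lam_gt1; rewrite -e; lra.
Qed.

Let Y_inj : injective Y := internal_inj v0 M_unit lam_gt1 Mv.
Let YM := internalM v0 vw Mv Mw.

Let K := Qadj lam.
Let KE : K = Qadj (v 1 0 / v 0 0).
Proof. exact: Qadj_eigen Mv YM mu_neq_lam. Qed.

Lemma common_denominator x y : K x -> K y ->
  exists (n : nat) z z', [/\ (0 < n)%N, x = Y z / n%:R & y = Y z' / n%:R].
Proof.
rewrite KE => /(Qadj_internal_div v0)[n [z [n0 ->]]] /(Qadj_internal_div v0)[n' [z' [n'0 ->]]].
exists (n * n')%N, (z *+ n'), (z' *+ n); rewrite muln_gt0 n0 n'0 !raddfMn natrM; split=> //.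
  by rewrite -[_ *+ n']mulr_natr; field; rewrite !pnatr_eq0 -!lt0n n0 n'0.
by rewrite -[_ *+ n]mulr_natr; field; rewrite !pnatr_eq0 -!lt0n n0 n'0.
Qed.

(** The windows enter only through the lattice points of their strips, so a regular window may be
    described as closed at either end. *)
Lemma forward_core (O' : window R) (mode : option bool) (s : bool) :
  let s' := side mu mode s in
  let delta := mu * wlo O - wlo O' in
  K delta -> good mode s ->
  (forall s y, good mode s -> win (wlen O) s y ->
     win (wlen O) (side mu mode s) (mu * y + delta)) ->
  (forall z, wset O (Y z) <-> win (wlen O) s (Y z - wlo O)) ->
  (forall z, wset O' (Y z) <-> win (wlen O) s' (Y z - wlo O')) ->
  mode = None \/ (exists k, wlo O' = wlo O + Y k) ->
  exists (s : subst_rule R) (T : set (R * label s)),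
       [/\ inflation s = lam,
           labels v w O T /\ is_subst_tiling T,
           associated_matrix v w O T M,
           labels v w O' (subst T) &
           loc_iso T (subst T)].
Proof.
move=> s' delta Kd gs iw sO sO' hm.
have len_gt0 := wlen_gt0 O.
have [B B0 hB] := nstep_bounded C len_gt0.
have [n [zl [zd [n0 lE dE]]]] := common_denominator O_len Kd.
have XM := physcM vw Mv Mw.
have MK (z : 'cV[int]_2) : M *m (invmx M *m z) = z by rewrite mulKVmx.
have E : mu * wlo O - delta = wlo O' by rewrite /delta; ring.
have [||r [T [rl Tst Tt Tl [TV T'V]]]] := @exists_rule _ _ C _ len_gt0 lam mu
    (mulmx M) (mulmx (invmx M)) lam_gt1 mu0 XM YM MK n delta zl zd n0 lE dE mode iw B hB
    s (wlo O).
- by [].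
- by rewrite E.
rewrite E in T'V; exists r, T; split=> //.
- split=> //; split; first by case: Tst.
  rewrite TV (proj_verticesE w v0); congr image; apply/seteqP.
  by split=> z /= /sO.
- exact: associated_matrix_of_inflation.
split=> //; rewrite T'V (proj_verticesE w v0); congr image; apply/seteqP.
by split=> z /= /sO'.
Qed.

Lemma forward (O' : window R) :
  admissible_window v M lam O O' -> matching_ends v M O O' ->
  exists (s : subst_rule R) (T : set (R * label s)),
       [/\ inflation s = lam,
           labels v w O T /\ is_subst_tiling T,
           associated_matrix v w O T M,
           labels v w O' (subst T) &
           loc_iso T (subst T)].
Proof.
have PM := PiYM_mulr v0 vw Mv Mw.
move=> [lenE /(strip_imageE v0 PM) MO Klen] ends; rewrite (PiYM_E v0 PM) in Klen.
have [U [UE Us Ulo Uhi]] := scale_window O mu0.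
have UO' : wset U `<=` wset O' by rewrite UE.
have [b1 b2] := wset_sub_bounds UO'; have lohi := wlohi O; have lohi' := wlohi O'.
move: lenE; rewrite /wlen => lenE.
pose delta := mu * wlo O - wlo O'.
have irr := slope_irrational v0 Y_inj.
have [t [d quad]] := slope_quadratic v0 Y_inj Mv YM mu_neq_lam.
have Kgap : K (wlo U - wlo O').
  rewrite -UE in Klen; have [->|[y yg <-]] := gap_below_exists UO'.
    by rewrite subrr -(rmorph0 ratr); exact: Qadj_rat.
  exact: Klen.
have Kmu : K mu.
  have : mu * 1 = Y (M *m e1) by rewrite YM internal_e1.
  by rewrite mulr1 KE => ->; exact: Qadj_internal.
(* For negative [mu] the lower end of the image comes from the upper end of [O], which adds a term
   [mu * wlen O]. *)
have Kd : K delta.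
  move: Kgap; rewrite Ulo /delta; case: ifP => // _ h.
  have -> : mu * wlo O - wlo O' = mu * whi O - wlo O' - mu * wlen O by rewrite /wlen; ring.
  move: h Kmu O_len; rewrite -/K KE => h Kmu' Kl.
  by apply: QadjB => //; exact: QadjM quad _ _ Kmu' Kl.
have iw_none s y : win (wlen O) s y ->
    win (wlen O) (s (+) (mu < 0)) (mu * y + delta).
  move: b1 b2; rewrite Ulo Uhi /delta /wlen; have [mun|mup] := ltP mu 0.
    case: s => /= b1 b2 /andP[y1 y2].
      have : mu * y <= 0 by rewrite nmulr_rle0.
      have : mu * (whi O - wlo O) < mu * y by rewrite ltr_nM2l.
      by rewrite mulrBr; lra.
    have : mu * y < 0 by rewrite nmulr_rlt0.
    have : mu * (whi O - wlo O) <= mu * y by rewrite ler_nM2l.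
    by rewrite mulrBr; lra.
  have {}mup : 0 < mu by rewrite lt_neqAle eq_sym mu0.
  case: s => /= b1 b2 /andP[y1 y2].
    have : 0 <= mu * y by rewrite pmulr_rge0.
    have : mu * y < mu * (whi O - wlo O) by rewrite ltr_pM2l.
    by rewrite mulrBr; lra.
  have : 0 < mu * y by rewrite pmulr_rgt0.
  have : mu * y <= mu * (whi O - wlo O) by rewrite ler_pM2l.
  by rewrite mulrBr; lra.
have sE z : wset O (Y z) <-> win (wlen O) (wside O) (Y z - wlo O) by exact: wsetE.
have s'E z : wset O' (Y z) <-> win (wlen O) (wside O') (Y z - wlo O').
  by rewrite wsetE /wlen lenE.
have flip (V : window R) s z : regular_window v V ->
    wset V (Y z) <-> win (wlen V) s (Y z - wlo V).
  move=> /(_ z)[]; rewrite -/(Y z) => n1 n2.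
  have [h1 h2] : (0 == Y z - wlo V) = false /\ (Y z - wlo V == wlen V) = false.
    split; first by rewrite eq_sym subr_eq0 (negPf n1).
    by rewrite /wlen (inj_eq (addIr _)) (negPf n2).
  by rewrite wsetE /win; case: s; case: (wside V); rewrite ?le_eqVlt ?h1 ?h2.
case: ends => [[U' U'E U's]|reg|reg|[k kE]].
- have [s1 _] : wside U = wside U' /\ wlo U = wlo U'.
    by apply: wset_inj; rewrite UE U'E (PiYM_E v0 PM).
  apply: (@forward_core O' None (wside O)) => //.
  + by move=> s y _; exact: iw_none.
  + by move=> z; rewrite /side -Us s1 U's.
  + by left.
(* A regular [O] is taken as closed at the end that inflation carries to the closed end of [O']. *)
- apply: (@forward_core O' None (wside O' (+) (mu < 0))) => //.
  + by move=> s y _; exact: iw_none.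
  + by move=> z; exact: flip.
  + by move=> z; rewrite /side -addbA addbb addbF.
  + by left.
- apply: (@forward_core O' None (wside O)) => //.
  + by move=> s y _; exact: iw_none.
  + by move=> z; rewrite (flip O' (side mu None (wside O)))// /wlen lenE.
  + by left.
have [U' [U'E U's U'lo]] := shift_window O (Y k).
have [s1 l1] : wside O' = wside U' /\ wlo O' = wlo U'.
  by apply: wset_inj; rewrite kE U'E.
(* A lattice translate has the kind of [O] whatever the sign of [mu], hence the labelling with a
   fixed kind. The image condition is now inclusion (ii) itself, ends included. *)
apply: (@forward_core O' (Some (wside O)) (wside O)) => //.
- exact: eqxx.
- move=> s y /eqP-> yW; have /MO : [set mu * y | y in wset O] (mu * (wlo O + y)).
    by exists (wlo O + y) => //; apply/wsetE; rewrite addrAC subrr add0r.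
  rewrite wsetE s1 U's /side {1}/wlen lenE.
  by have -> : mu * (wlo O + y) - wlo O' = mu * y + delta by rewrite /delta; ring.
- by move=> z; rewrite /side -U's -s1.
by right; exists k; rewrite l1 U'lo.
Qed.

End Forward.

(** * Substitution tilings *)

Section Tilings.
Variables (R : realType) (r : subst_rule R).
Implicit Types T : set (R * label r).
Notation L := (inflation r).
Notation len := (@tlen R r).

Let L_gt0 : 0 < L. Proof. exact: lt_trans (inflation_gt1 r). Qed.

Lemma tiling_consecutive T t x : is_tiling T -> T t -> vertices T x -> t.1 < x ->
  t.1 + len t.2 <= x.
Proof.
move=> tT Tt [t' Tt' <-] tt'; rewrite leNgt; apply/negP => h.
have [u [_ uu]] := tT t'.1.
have e1 : u = t by apply: uu; split=> //; rewrite (ltW tt').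
have e2 : u = t' by apply: uu; split=> //; rewrite lexx ltrDl tlen_gt0.
by move: tt'; rewrite -e1 -e2 ltxx.
Qed.

Lemma tiling_end T t : is_tiling T -> T t -> vertices T (t.1 + len t.2).
Proof.
move=> tT Tt; have [t' [[Tt' /andP[]] + + _]] := tT (t.1 + len t.2).
rewrite le_eqVlt => /orP[/eqP e _|lt1 lt2]; first by exists t'.
have l0 := tlen_gt0 t.2.
have [tt'|t't] := ltP t.1 t'.1.
  by have := tiling_consecutive tT Tt (ex_intro2 _ _ t' Tt' erefl) tt'; rewrite leNgt lt1.
move: t't; rewrite le_eqVlt => /orP[/eqP e|t't].
  have [u [_ uu]] := tT t.1.
  have e1 : u = t by apply: uu; split=> //; rewrite lexx ltrDl.
  have e2 : u = t' by apply: uu; split=> //; rewrite e lexx ltrDl tlen_gt0.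
  by move: lt2; rewrite -e1 -e2 ltxx.
have := tiling_consecutive tT Tt' (ex_intro2 _ _ t Tt erefl) t't; lra.
Qed.

Lemma sum_take_lt (s : seq (label r)) l0 i j : (i < j <= size s)%N ->
  \sum_(k <- take i s) len k + len (nth l0 s i) <= \sum_(k <- take j s) len k.
Proof.
move=> /andP[ij js]; have is_ : (i < size s)%N := leq_trans ij js.
have <- : \sum_(k <- take i.+1 s) len k = \sum_(k <- take i s) len k + len (nth l0 s i).
  by rewrite (take_nth l0)// -cats1 big_cat /= big_seq1.
rewrite -[in leRHS](subnKC ij) -[take (_ + _) s]/(_) takeD big_cat /=.
by rewrite lerDl sumr_ge0// => k _; rewrite ltW// tlen_gt0.
Qed.

Lemma sum_locate (s : seq (label r)) l0 x : 0 <= x < \sum_(k <- s) len k ->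
  exists2 i, (i < size s)%N &
    \sum_(k <- take i s) len k <= x < \sum_(k <- take i s) len k + len (nth l0 s i).
Proof.
elim: s x => [|l s IH] x; first by rewrite big_nil; lra.
rewrite big_cons => /andP[x0 xl]; have [h|h] := ltP x (len l).
  by exists 0%N => //=; rewrite big_nil add0r x0.
have [|i im] := IH (x - len l); first by lra.
by move=> /andP[h1 h2]; exists i.+1 => //=; rewrite big_cons; apply/andP; split; lra.
Qed.

Lemma subst_tiling T : is_tiling T -> is_tiling (subst T).
Proof.
move=> tT x.
have scale t y : t.1 <= y / L < t.1 + len t.2 <->
    L * t.1 <= y < L * t.1 + L * len t.2.
  by rewrite ler_pdivlMr// ltr_pdivrMr// -mulrDr ![_ * L]mulrC.
have [t [[Tt /scale tx] tu]] := tT (x / L).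
have [|i im ix] := @sum_locate (repl t.2) t.2 (x - L * t.1).
  by rewrite repl_len; lra.
exists (L * t.1 + \sum_(k <- take i (repl t.2)) len k, nth t.2 (repl t.2) i).
split=> [|_ [[t' [j [Tt' jm ->]]] /= jx]].
  by split=> /=; [exists t, i|lra].
have tt' : t = t'.
  apply: tu; split=> //; apply/scale; rewrite -repl_len.
  have := @sum_take_lt (repl t'.2) t'.2 j (size (repl t'.2)).
  rewrite jm leqnn take_size => /(_ isT).
  have : 0 <= \sum_(k <- take j (repl t'.2)) len k.
    by apply: sumr_ge0 => k _; rewrite ltW// tlen_gt0.
  by lra.
move: jm jx; rewrite -tt' {tt'} => jm jx.
case: (ltngtP i j) => [ij|ji|->//]; exfalso.
  by have := @sum_take_lt (repl t.2) t.2 i j; rewrite ij ltnW// => /(_ isT); lra.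
by have := @sum_take_lt (repl t.2) t.2 j i; rewrite ji ltnW// => /(_ isT); lra.
Qed.

Lemma subst_occur T T' : patches_occur T T' -> patches_occur (subst T) (subst T').
Proof.
move=> o P Pfin PT.
have /choice[f hf] : forall u, exists ti, P u ->
    [/\ T ti.1, (ti.2 < size (repl ti.1.2))%N &
     u = (L * ti.1.1 + \sum_(k <- take ti.2 (repl ti.1.2)) len k,
          nth ti.1.2 (repl ti.1.2) ti.2)].
  move=> u; have [/PT[t [i h]]|nP] := pselect (P u); first by exists (t, i).
  by exists (u, 0%N).
have [||a ha] := o [set (f u).1 | u in P]; first exact: finite_image.
  by move=> _ [u /hf[h _ _] <-].
exists (L * a) => _ [u Pu <-]; have [h1 h2 h3] := hf u Pu.
exists ((f u).1.1 + a, (f u).1.2), (f u).2; split=> //.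
  by apply: ha; exists (f u).1 => //; exists u.
by rewrite {1 2}h3 /= mulrDr addrAC.
Qed.

(** [T] is the substitution of some [T'] locally isomorphic to it, and substitution preserves local
    isomorphism. *)
Lemma subst_loc_iso T : is_subst_tiling T -> loc_iso T (subst T).
Proof.
case=> _ /(_ 1%N) [T' [_ [hTT' hT'T] E]]; rewrite /= in E.
by split; [rewrite -{1}E|rewrite -{2}E]; exact: subst_occur.
Qed.

Lemma subst_start T t : T t -> vertices (subst T) (L * t.1).
Proof.
move=> Tt; have := repl_len t.2; case E : (repl t.2) => [|l s].
  rewrite big_nil => /esym/eqP; rewrite mulf_eq0 !gt_eqF//; exact: tlen_gt0.
move=> _; exists (L * t.1 + \sum_(k <- take 0 (repl t.2)) len k, nth t.2 (repl t.2) 0).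
  by exists t, 0%N; split=> //; rewrite E.
by rewrite take0 big_nil addr0.
Qed.

Lemma subst_end T t : is_tiling T -> T t ->
  vertices (subst T) (L * (t.1 + len t.2)).
Proof. by move=> tT /(tiling_end tT)[t' Tt' <-]; exact: subst_start. Qed.

End Tilings.

(** * Infima and suprema as signed ends *)

Section Ends.
Variable R : realType.
Implicit Types (A : set R) (sg e : R).

(* [e] is the infimum of [A] if [sg > 0], and its supremum if [sg < 0]. *)
Definition is_end sg A e : Prop :=
  (forall x, A x -> 0 <= sg * (x - e)) /\
  (forall d, 0 < d -> exists2 x, A x & sg * (x - e) < d).

Lemma is_end_uniq sg A e e' : sg != 0 -> is_end sg A e -> is_end sg A e' -> e = e'.
Proof.
move=> sg0 [h1 h2] [k1 k2].
have le f f' : (forall x, A x -> 0 <= sg * (x - f)) ->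
    (forall d, 0 < d -> exists2 x, A x & sg * (x - f') < d) -> sg * f <= sg * f'.
  move=> h k; rewrite leNgt; apply/negP => lt.
  have [|x Ax] := k (sg * f - sg * f'); first by rewrite subr_gt0.
  by have := h _ Ax; rewrite !mulrBr; lra.
by apply: (mulfI sg0); apply/eqP; rewrite eq_le !le.
Qed.

Lemma is_end_scale sg c A e : 0 < c -> is_end sg A e -> is_end (c * sg) A e.
Proof.
move=> c0 [h1 h2]; split=> [x Ax|d d0]; first by rewrite -mulrA mulr_ge0 ?h1// ltW.
have [|x Ax xd] := h2 (d / c); first by rewrite divr_gt0.
by exists x => //; rewrite -mulrA mulrC -ltr_pdivlMr.
Qed.

Lemma is_end_affine sg nu q A e : is_end (sg * nu) A e ->
  is_end sg [set nu * x + q | x in A] (nu * e + q).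
Proof.
have E x : sg * (nu * x + q - (nu * e + q)) = sg * nu * (x - e) by ring.
move=> [h1 h2]; split=> [_ [x Ax <-]|d d0]; first by rewrite E; exact: h1.
by have [x Ax xd] := h2 d d0; exists (nu * x + q); [exists x|rewrite E].
Qed.

Lemma exists_end sg A p q : sg != 0 -> A !=set0 -> (forall x, A x -> p <= x <= q) ->
  exists e, is_end sg A e.
Proof.
move=> sg0 A0 Ab.
have hs : has_sup A by split=> //; exists q => x /Ab/andP[].
have hi : has_inf A by split=> //; exists p => x /Ab/andP[].
move: sg0; rewrite neq_lt => /orP[sgn|sgp]; [exists (sup A)|exists (inf A)].
  have -> : sg = (- sg) * (-1) by ring.
  apply: is_end_scale; rewrite ?oppr_gt0//; split=> [x Ax|d d0].
    by have := ub_le_sup hs.2 Ax; lra.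
  by have [x Ax xd] := sup_adherent d0 hs; exists x => //; lra.
rewrite -[sg]mulr1; apply: is_end_scale => //; split=> [x Ax|d d0].
  by have := ge_inf hi.2 Ax; lra.
by have [x Ax xd] := inf_adherent d0 hi; exists x => //; lra.
Qed.

(** [A'] need only approximate [A + c] with arbitrarily small errors; local isomorphism transports
    sets of heights in just this sense. *)
Lemma is_end_shift sg A A' e c : is_end sg A e ->
  (forall x d, A x -> 0 < d -> exists2 x', A' x' & `|x' - (x + c)| <= d) ->
  (forall x d, A' x -> 0 < d -> exists2 x', A x' & `|x' - (x - c)| <= d) ->
  is_end sg A' (e + c).
Proof.
move=> [h1 h2] AA' A'A; have sg1 : 0 < `|sg| + 1 by rewrite ltr_wpDl.
have bound t d : `|t| <= d / (`|sg| + 1) -> 0 < d -> `|sg * t| < d.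
  rewrite ler_pdivlMr// => td d0; rewrite normrM.
  have [->|t0] := eqVneq t 0; first by rewrite normr0 mulr0.
  apply: lt_le_trans td; rewrite mulrDr mulr1 mulrC ltrDl normr_gt0//.
split=> [x A'x|d d0].
  rewrite leNgt; apply/negP => lt.
  have d0 : 0 < - (sg * (x - (e + c))) by rewrite oppr_gt0.
  have [x' Ax' hx'] := A'A x _ A'x (divr_gt0 d0 sg1).
  have := bound _ _ hx' d0; have := h1 _ Ax'.
  have -> : sg * (x' - e) = sg * (x' - (x - c)) + sg * (x - (e + c)) by ring.
  by rewrite ltr_norml; lra.
have d2 : 0 < d / 2 by rewrite divr_gt0.
have [x Ax xd] := h2 _ d2; have [x' A'x' hx'] := AA' x _ Ax (divr_gt0 d2 sg1).
exists x' => //; have := bound _ _ hx' d2.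
have -> : sg * (x' - (e + c)) = sg * (x' - (x + c)) + sg * (x - e) by ring.
by rewrite ltr_norml; lra.
Qed.

(** Otherwise each member would keep a positive distance from [e], and so would their finite
    union. *)
Lemma is_end_union sg (I : finType) (D : I -> Prop) (A : I -> set R) e :
  is_end sg [set x | exists2 i, D i & A i x] e -> exists2 i, D i & is_end sg (A i) e.
Proof.
move=> [h1 h2]; apply: contrapT => no.
have [||d d0 hd] := @finite_radius R I [set i | D i]
    (fun i t => forall x, A i x -> t <= sg * (x - e)).
- exact: finite_finset.
- move=> i Di; apply: contrapT => no'; apply: no; exists i => //; split=> [x Ax|d d0].
    by apply: h1; exists i.
  apply: contrapT => no''; apply: no'; exists d => // t /andP[t0 td] x Ax.
  rewrite leNgt; apply/negP => lt; apply: no''; exists x => //; exact: lt_trans td.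
have d2 : 0 < d / 2 by rewrite divr_gt0.
have [x [i Di Aix] xd] := h2 _ d2.
have : d / 2 <= sg * (x - e) by apply: (hd i) => //; apply/andP; split; lra.
by rewrite leNgt xd.
Qed.

End Ends.

(** * The window of a substituted tiling *)

Section Backward.
Variables (R : realType) (G : zmodType) (C : cutproj R G) (len : R).
Hypothesis len_gt0 : 0 < len.
Notation X := (px C).
Notation Y := (py C).
Notation win := (win len).
Variables (r : subst_rule R) (T : set (R * label r)) (s : bool) (a : R).
Notation L := (inflation r).
Notation tile := (R * label r)%type.
Notation S := [set z | win s (Y z - a)].
Hypothesis T_tiling : is_tiling T.
Hypothesis T_vertices : vertices T = [set X z | z in S].
Hypothesis T_loc_iso : loc_iso T (subst T).
Variables (N : {additive G -> G}) (nu : R).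
Hypothesis XN : forall z, X (N z) = L * X z.
Hypothesis YN : forall z, Y (N z) = nu * Y z.

Let L_gt0 : 0 < L. Proof. exact: lt_trans (inflation_gt1 r). Qed.

Definition occurs l := `[< exists x, T (x, l) >].

Lemma tile_vertex t : T t -> exists2 z, S z & X z = t.1.
Proof. by move=> Tt; have : vertices T t.1 by [exists t]; rewrite T_vertices. Qed.

Lemma vertex_tile z : S z -> exists l, T (X z, l).
Proof.
move=> Sz; have : vertices T (X z) by rewrite T_vertices; exists z.
by move=> [[x l] Txl /= <-]; exists l.
Qed.

Lemma occurs_step l : occurs l -> exists q, X q = tlen l.
Proof.
move=> /asboolP[x Txl]; have [z Sz zx] := tile_vertex Txl.
have := tiling_end T_tiling Txl; rewrite T_vertices => -[z' _ z'x].
by exists (z' - z); rewrite raddfB z'x zx /= addrAC subrr add0r.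
Qed.

Lemma occurs_sum ls : (forall l, l \in ls -> occurs l) ->
  exists q, X q = \sum_(k <- ls) tlen k.
Proof.
elim: ls => [|l ls IH] h; first by exists 0; rewrite raddf0 big_nil.
have [q qE] := occurs_step (h l (mem_head _ _)).
have [|q' q'E] := IH; first by move=> k kl; apply: h; rewrite inE kl orbT.
by exists (q + q'); rewrite raddfD qE q'E big_cons.
Qed.

Lemma occurs_subst u : subst T u -> occurs u.2.
Proof.
move=> Tu; have [||c hc] := T_loc_iso.2 [set u]; first exact: finite_set1.
  by move=> _ ->.
by apply/asboolP; exists (u.1 + c); apply: hc; exists u.
Qed.

Lemma occurs_repl k l : occurs k -> l \in repl k -> occurs l.
Proof.
move=> /asboolP[x Txk] lk; pose i := index l (repl k).
have /occurs_subst : subst T (L * x + \sum_(j <- take i (repl k)) tlen j, nth k (repl k) i).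
  by exists (x, k), i; split=> //=; rewrite index_mem.
by rewrite /= nth_index.
Qed.

Lemma occurs_prefix k i : occurs k ->
  exists q, X q = \sum_(j <- take i (repl k)) tlen j.
Proof. by move=> kP; apply: occurs_sum => l /mem_take; exact: occurs_repl. Qed.

Lemma subst_vertex x : vertices (subst T) x -> exists z, x = X z.
Proof.
move=> [_ [t [i [Tt im ->]]] <-] /=; have [z _ zt] := tile_vertex Tt.
have tP : occurs t.2 by apply/asboolP; exists t.1; case: (t) Tt.
have [q qE] := occurs_prefix i tP.
by exists (N z + q); rewrite raddfD XN zt qE.
Qed.

Definition is_lift z := vertices (subst T) (X z).

Lemma lift_N z : S z -> is_lift (N z).
Proof. by move=> /vertex_tile[l Tl]; rewrite /is_lift XN; exact: (subst_start Tl). Qed.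

Let S_mid : exists z, S z.
Proof.
have [z zY] : exists k, a < Y k < a + len by apply: py_dense; rewrite ltrDl.
by exists z; apply: win_open; lra.
Qed.

Lemma lift_tile z : is_lift z -> exists l, subst T (X z, l).
Proof. by move=> [[x l] Tx /= <-]; exists l. Qed.

Lemma tiling_lift z l : T (X z, l) -> S z.
Proof.
by move=> /tile_vertex[z' Sz' /= /(px_inj (c := C)) <-].
Qed.

(** A translation carrying a lattice vertex to a lattice vertex comes from a lattice vector, so
    recurrence of patches becomes a statement about heights. *)
Lemma occur_lattice T1 T2 (ts : seq (G * label r)) :
  patches_occur T1 T2 -> (forall x, vertices T2 x -> exists z, x = X z) ->
  (forall t, t \in ts -> T1 (X t.1, t.2)) ->
  exists k, forall t, t \in ts -> T2 (X (t.1 + k), t.2).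
Proof.
move=> o12 v2; case: ts => [|t0 ts] h; first by exists 0.
have [||c hc] := o12 [set (X t.1, t.2) | t in [set` t0 :: ts]].
- by apply: finite_image; exact: finite_seq.
- by move=> _ [t tts <-]; exact: h.
have tc t : t \in t0 :: ts -> T2 (X t.1 + c, t.2).
  by move=> tts; apply: hc; exists (X t.1, t.2) => //; exists t.
have [z0 z0E] : exists z, X t0.1 + c = X z.
  by apply: v2; exists (X t0.1 + c, t0.2) => //; apply: tc; exact: mem_head.
have cE : c = X (z0 - t0.1) by rewrite raddfB -z0E addrAC subrr add0r.
by exists (z0 - t0.1) => t /tc; rewrite cE [X (t.1 + _)]raddfD.
Qed.

Lemma T_vertex_lift x : vertices T x -> exists z, x = X z.
Proof. by rewrite T_vertices => -[z _ <-]; exists z. Qed.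

Lemma pull_back (ts : seq (G * label r)) :
  (forall t, t \in ts -> subst T (X t.1, t.2)) ->
  exists k, forall t, t \in ts -> T (X (t.1 + k), t.2).
Proof. exact: occur_lattice T_loc_iso.2 T_vertex_lift. Qed.

Lemma push_forward (ts : seq (G * label r)) :
  (forall t, t \in ts -> T (X t.1, t.2)) ->
  exists k, forall t, t \in ts -> subst T (X (t.1 + k), t.2).
Proof. exact: occur_lattice T_loc_iso.1 subst_vertex. Qed.

(** The two tiles recur together in [T]; the strict inequality reflects that its window is
    half-open. *)
Lemma lift_diff z z' : is_lift z -> is_lift z' -> Y z' < Y z + len.
Proof.
move=> /lift_tile[l zl] /lift_tile[l' zl'].
have [|k hk] := @pull_back [:: (z, l); (z', l')].
  by move=> t; rewrite !inE => /orP[]/eqP->.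
have /tiling_lift /= := hk _ (mem_head _ _).
have /tiling_lift /= : T (X (z' + k), l') by apply: (hk (z', l')); rewrite !inE eqxx orbT.
by rewrite !raddfD /=; case: (s) => /=; lra.
Qed.

Lemma exists_lift : exists z, is_lift z.
Proof. by have [z /lift_N] := S_mid; exists (N z). Qed.

Definition alo := inf [set Y z | z in is_lift].

Lemma alo_le z : is_lift z -> alo <= Y z.
Proof.
move=> zl; apply: ge_inf; last by exists z.
by exists (Y z - len) => _ [z' z'l <-]; have := lift_diff z'l zl; lra.
Qed.

Lemma alo_approx d : 0 < d -> exists2 z, is_lift z & Y z < alo + d.
Proof.
move=> d0; have [z0 z0l] := exists_lift.
have hi : has_inf [set Y z | z in is_lift].
  split; first by exists (Y z0); exists z0.
  by exists (Y z0 - len) => _ [z' z'l <-]; have := lift_diff z'l z0l; lra.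
by have [_ [z zl <-] zd] := inf_adherent d0 hi; exists z.
Qed.

Lemma ahi_ge z : is_lift z -> Y z <= alo + len.
Proof.
move=> zl; rewrite leNgt; apply/negP => lt.
have [|z' z'l] := @alo_approx (Y z - (alo + len)); first by rewrite subr_gt0.
by have := lift_diff z'l zl; lra.
Qed.

Lemma S_near y d : a <= y <= a + len -> 0 < d -> exists2 z, S z & `|Y z - y| < d.
Proof.
move=> yb d0; have l0 := len_gt0; have : Num.max a (y - d) < Num.min (a + len) (y + d).
  by rewrite lt_min !gt_max; apply/andP; split; apply/andP; split; lra.
move=> /(@py_dense _ _ C)[z]; rewrite gt_max lt_min => /andP[/andP[h1 h2] /andP[h3 h4]].
exists z; first by apply: win_open; lra.
by rewrite ltr_norml; lra.
Qed.

(** Vertices of [T] near the two ends of its window keep their difference of heights, nearly [len],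
    when pushed forward. *)
Lemma ahi_approx d : 0 < d -> exists2 z, is_lift z & alo + len - d < Y z.
Proof.
move=> d0; have d2 : 0 < d / 2 by rewrite divr_gt0.
have [||z Sz] := @S_near a (d / 2); rewrite ?lexx ?lerDl ?ltW//.
have [||z' Sz'] := @S_near (a + len) (d / 2); rewrite ?lexx ?lerDl ?ltW//.
rewrite !ltr_norml => z'Y zY; have [l zl] := vertex_tile Sz; have [l' zl'] := vertex_tile Sz'.
have [|k hk] := @push_forward [:: (z, l); (z', l')].
  by move=> t; rewrite !inE => /orP[]/eqP->.
have z1 : is_lift (z + k) by exists (X (z + k), l) => //; apply: (hk (z, l)); exact: mem_head.
have z2 : is_lift (z' + k).
  by exists (X (z' + k), l') => //; apply: (hk (z', l')); rewrite !inE eqxx orbT.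
exists (z' + k) => //; have := alo_le z1; rewrite !raddfD /=; lra.
Qed.

(** [X z] is interior to the tile found here; wherever that tile recurs in [T], the translated point
    is interior to it and cannot be a vertex. *)
Lemma not_lift z : ~ is_lift z -> exists u l, subst T (X u, l) /\
  forall k, T (X (u + k), l) -> ~ S (z + k).
Proof.
move=> nz; have [[x l] [[T'xl /= zx] _]] := subst_tiling T_tiling (X z).
have [u uE] : exists u, x = X u by apply: subst_vertex; exists (x, l).
subst x; exists u, l; split=> // k uk zk.
have uz : X u < X z.
  move: zx => /andP[]; rewrite le_eqVlt => /orP[/eqP e _|//].
  by case: nz; rewrite /is_lift -e; exists (X u, l).
have : vertices T (X (z + k)) by rewrite T_vertices; exists (z + k).
move=> /(tiling_consecutive T_tiling uk) /=; rewrite !raddfD /=; lra.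
Qed.

(* A lattice point inside the strip that is not a vertex of the tiling would lie
   between two consecutive vertices; a patch containing these and vertices below
   and above the point would recur in a tiling where the point is a vertex. *)
Lemma lift_inside z : alo < Y z < alo + len -> is_lift z.
Proof.
move=> zY; apply: contrapT => /not_lift[u [l [ul uz]]].
have [|p /lift_tile[lp pl] pY] := @alo_approx (Y z - alo); first lra.
have [|q /lift_tile[lq ql] qY] := @ahi_approx (alo + len - Y z); first lra.
have [|k hk] := @pull_back [:: (u, l); (p, lp); (q, lq)].
  by move=> t; rewrite !inE => /or3P[]/eqP->.
apply: (uz k); first by apply: (hk (u, l)); exact: mem_head.
have /tiling_lift pk : T (X (p + k), lp) by apply: (hk (p, lp)); rewrite !inE eqxx orbT.
have /tiling_lift qk : T (X (q + k), lq) by apply: (hk (q, lq)); rewrite !inE eqxx !orbT.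
have := win_bounds pk; have := win_bounds qk.
by rewrite /= !raddfD /= => hq hp; apply: win_open; lra.
Qed.

Lemma lift_window : exists s', forall z, is_lift z <-> win s' (Y z - alo).
Proof.
have [[z0 z0l z0Y]|no] := pselect (exists2 z, is_lift z & Y z = alo).
  exists true => z; rewrite /=; split=> [zl|/andP[]].
    by have := alo_le zl; have := lift_diff z0l zl; rewrite z0Y; lra.
  rewrite le_eqVlt => /orP[/eqP h _|h1 h2]; last by apply: lift_inside; lra.
  by have -> : z = z0 by apply: (py_inj (c := C)); lra.
have [[z1 z1l z1Y]|no'] := pselect (exists2 z, is_lift z & Y z = alo + len).
  exists false => z; rewrite /=; split=> [zl|/andP[h1]].
    by have := ahi_ge zl; have := lift_diff zl z1l; rewrite z1Y; lra.
  rewrite le_eqVlt => /orP[/eqP h|h2]; last by apply: lift_inside; lra.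
  by have -> : z = z1 by apply: (py_inj (c := C)); lra.
have inside z : is_lift z -> alo < Y z < alo + len.
  move=> zl; have := alo_le zl; have := ahi_ge zl.
  rewrite !le_eqVlt => /orP[/eqP h|->]; first by case: no'; exists z.
  by move=> /orP[/eqP h|->//]; case: no; exists z.
have [[z zY]|noz] := pselect (exists z, Y z = alo); last first.
  exists true => z; split=> [/inside|/=]; first by move=> h /=; lra.
  move=> /andP[]; rewrite le_eqVlt => /orP[/eqP h|h1 h2]; last by apply: lift_inside; lra.
  by case: noz; exists z; lra.
have [[z' z'Y]|noz'] := pselect (exists z, Y z = alo + len); last first.
  exists false => z'; split=> [/inside|/=]; first by move=> h /=; lra.
  move=> /andP[h1]; rewrite le_eqVlt => /orP[/eqP h|h2]; last by apply: lift_inside; lra.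
  by case: noz'; exists z'; lra.
(* Now both ends are heights of lattice points and neither point is a vertex. The tiles witnessing
   this recur together in [T], whose half-open window contains one of any two heights at distance
   [len] that enclose one of its points. *)
have nz : ~ is_lift z by move=> /inside; lra.
have nz' : ~ is_lift z' by move=> /inside; lra.
have [u [l [ul uz]]] := not_lift nz; have [u' [l' [u'l' u'z']]] := not_lift nz'.
have /inside uin : is_lift u by exists (X u, l).
have /inside u'in : is_lift u' by exists (X u', l').
have [|k hk] := @pull_back [:: (u, l); (u', l')].
  by move=> t; rewrite !inE => /orP[]/eqP->.
have uk : T (X (u + k), l) by apply: (hk (u, l)); exact: mem_head.
have u'k : T (X (u' + k), l') by apply: (hk (u', l')); rewrite !inE eqxx orbT.
have := tiling_lift uk; have := tiling_lift u'k; have := uz _ uk; have := u'z' _ u'k.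
by rewrite /= !raddfD /= zY z'Y; case: (s) => /= /negP h1 /negP h2 h3 h4; exfalso;
  move: h1 h2; rewrite !negb_and -?ltNge -?leNgt => /orP[] h1 /orP[] h2; lra.
Qed.

Lemma nu_neq0 : nu != 0.
Proof.
have [q [q0 _]] := cp_up C ltr01; apply/eqP => n0.
have : N q = 0 by apply: (py_inj (c := C)); rewrite YN n0 mul0r raddf0.
by move=> /(congr1 X)/eqP; rewrite XN raddf0 mulf_eq0 !gt_eqF.
Qed.

Lemma lift_bound y : a <= y <= a + len -> alo <= nu * y <= alo + len.
Proof.
move=> yb; have n0 : 0 < `|nu| by rewrite normr_gt0 nu_neq0.
have near d : 0 < d -> exists2 z, is_lift z & `|Y z - nu * y| < d.
  move=> d0; have [z Sz zd] := S_near yb (divr_gt0 d0 n0).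
  exists (N z); first exact: lift_N.
  by rewrite YN -mulrBr normrM mulrC -ltr_pdivlMr.
apply/andP; split; rewrite leNgt; apply/negP => lt.
  have [|z /alo_le zl] := near (alo - nu * y); first by rewrite subr_gt0.
  by rewrite ltr_norml; lra.
have [|z /ahi_ge zl] := near (nu * y - (alo + len)); first by rewrite subr_gt0.
by rewrite ltr_norml; lra.
Qed.

(** The image window is no longer than [len]. A factor of absolute value 1 would make [N] act as
    plus or minus the identity, against the expansion by [L]. *)
Lemma nu_lt1 : `|nu| < 1.
Proof.
have l0 := len_gt0.
have h1 := @lift_bound a; have h2 := @lift_bound (a + len).
have {}h1 : alo <= nu * a <= alo + len by apply: h1; lra.
have {}h2 : alo <= nu * (a + len) <= alo + len by apply: h2; lra.
rewrite lt_neqAle; apply/andP; split; last first.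
  rewrite -(ler_pM2r len_gt0) mul1r -{1}(gtr0_norm len_gt0) -normrM ler_norml.
  by move: h2; rewrite mulrDr; lra.
have [q [q0 _]] := cp_up C ltr01; have L1 := inflation_gt1 r.
apply/eqP => n1; have : `|L * X q| = X q.
  rewrite -XN; have [np|nn] := leP 0 nu.
    rewrite ger0_norm// in n1.
    have -> : N q = q by apply: (py_inj (c := C)); rewrite YN n1 mul1r.
    by rewrite gtr0_norm.
  have {}n1 : nu = -1 by rewrite -n1 ltr0_norm// opprK.
  have -> : N q = - q by apply: (py_inj (c := C)); rewrite YN n1 mulN1r raddfN.
  by rewrite raddfN normrN gtr0_norm.
rewrite gtr0_norm ?mulr_gt0// => /eqP; rewrite gt_eqF// ltr_pMl//.
Qed.

(** Two vertices near the ends of the window are carried along; their images have to fit between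
    [alo] and [alo + len], which determines the height of [k] up to [d]. *)
Lemma tile_push z l d : T (X z, l) -> 0 < d ->
  exists2 k, subst T (X (z + k), l) & `|Y k - (alo - a)| <= d.
Proof.
move=> zl d0; have l0 := len_gt0.
have [||z1 Sz1] := @S_near a d; rewrite ?lexx ?lerDl ?ltW//.
have [||z2 Sz2] := @S_near (a + len) d; rewrite ?lexx ?lerDl ?ltW//.
rewrite !ltr_norml => Y2 Y1.
have [l1 zl1] := vertex_tile Sz1; have [l2 zl2] := vertex_tile Sz2.
have [|k hk] := @push_forward [:: (z, l); (z1, l1); (z2, l2)].
  by move=> t; rewrite !inE => /or3P[]/eqP->.
exists k; first by apply: (hk (z, l)); exact: mem_head.
have /alo_le k1 : is_lift (z1 + k).
  by exists (X (z1 + k), l1) => //; apply: (hk (z1, l1)); rewrite !inE eqxx orbT.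
have /ahi_ge k2 : is_lift (z2 + k).
  by exists (X (z2 + k), l2) => //; apply: (hk (z2, l2)); rewrite !inE eqxx !orbT.
by move: k1 k2; rewrite !raddfD /= ler_norml => k1 k2; lra.
Qed.

Lemma tile_pull z l d : subst T (X z, l) -> 0 < d ->
  exists2 k, T (X (z + k), l) & `|Y k - (a - alo)| <= d.
Proof.
move=> zl d0.
have [z1 /lift_tile[l1 zl1] Y1] := alo_approx d0.
have [z2 /lift_tile[l2 zl2] Y2] := ahi_approx d0.
have [|k hk] := @pull_back [:: (z, l); (z1, l1); (z2, l2)].
  by move=> t; rewrite !inE => /or3P[]/eqP->.
exists k; first by apply: (hk (z, l)); exact: mem_head.
have /tiling_lift/win_bounds k1 : T (X (z1 + k), l1).
  by apply: (hk (z1, l1)); rewrite !inE eqxx orbT.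
have /tiling_lift/win_bounds k2 : T (X (z2 + k), l2).
  by apply: (hk (z2, l2)); rewrite !inE eqxx !orbT.
by move: k1 k2; rewrite !raddfD /= ler_norml => k1 k2; lra.
Qed.

Definition labset (U : set tile) l : set R := [set Y z | z in [set z | U (X z, l)]].

Lemma labset_shift sg l e : is_end sg (labset T l) e ->
  is_end sg (labset (subst T) l) (e + (alo - a)).
Proof.
move=> h; apply: is_end_shift h _ _ => _ d [z /= zl <-] d0.
  have [k kl kd] := tile_push zl d0.
  by exists (Y (z + k));
    [exists (z + k)|rewrite raddfD [X in `|X|](_ : _ = Y k - (alo - a))//=; ring].
have [k kl kd] := tile_pull zl d0.
by exists (Y (z + k));
  [exists (z + k)|rewrite raddfD [X in `|X|](_ : _ = Y k - (a - alo))//=; ring].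
Qed.

Let pos := {k : label r & 'I_(size (repl k))}.

(** A position in a replacement has a fixed lattice offset, so each of the finitely many positions
    contributes an affine image. *)
Lemma labset_subst l : exists q : pos -> G, labset (subst T) l =
  [set x | exists2 i : pos, occurs (tag i) /\
      nth (tag i) (repl (tag i)) (tagged i) = l &
    [set nu * y + Y (q i) | y in labset T (tag i)] x].
Proof.
have /choice[q qE] : forall i : pos, exists q, occurs (tag i) ->
    X q = \sum_(j <- take (tagged i) (repl (tag i))) tlen j.
  move=> i; have [/(occurs_prefix (tagged i))[q qE]|_] := boolP (occurs (tag i)).
    by exists q.
  by exists 0.
exists q; apply/seteqP; split=> [_ [z [t [i [Tt im [zX lE]]]] <-]|].
  have tP : occurs t.2 by apply/asboolP; exists t.1; case: (t) Tt.
  have [u _ uX] := tile_vertex Tt; pose p : pos := Tagged _ (Ordinal im).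
  exists p; first by split=> //; rewrite lE.
  exists (Y u); first by exists u => //=; rewrite uX; case: (t) Tt.
  rewrite -YN -raddfD; congr (Y _); apply: (px_inj (c := C)).
  by rewrite raddfD XN uX zX (qE p).
move=> _ [i [iP iE] [_ [z zT <-] <-]]; rewrite -YN -raddfD.
exists (N z + q i) => //=; exists (X z, tag i), (tagged i); split=> //=.
by rewrite raddfD XN qE// iE.
Qed.

Lemma labset_bounds l x : labset T l x -> a <= x <= a + len.
Proof. by move=> [z /= /tiling_lift/win_bounds h <-]; lra. Qed.

Lemma exists_label_end sg l : sg != 0 -> occurs l -> exists e, is_end sg (labset T l) e.
Proof.
move=> sg0 /asboolP[x xl]; apply: exists_end sg0 _ (@labset_bounds l).
have [z _ zx] := tile_vertex xl.
by exists (Y z); exists z => //=; rewrite zx.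
Qed.

Lemma label_end_recursion sg l e : sg != 0 -> is_end sg (labset T l) e ->
  exists2 k, occurs k & exists q e',
    is_end (sg * nu) (labset T k) e' /\ e + (alo - a) = nu * e' + Y q.
Proof.
move=> sg0 /labset_shift; have [q ->] := labset_subst l.
move=> /is_end_union[i [iP _] ie]; exists (tag i) => //.
have sn0 : sg * nu != 0 by rewrite mulf_neq0// nu_neq0.
have [e' e'E] := exists_label_end sn0 iP; exists (q i), e'; split=> //.
exact: is_end_uniq sg0 ie (is_end_affine _ e'E).
Qed.

Lemma strip_lower_end : is_end 1 [set x | exists2 l, occurs l & labset T l x] a.
Proof.
split=> [x [l _ /labset_bounds]|d d0]; first by lra.
have l0 := len_gt0.
have [||z Sz] := @S_near a d; rewrite ?lexx ?lerDl ?ltW// ltr_norml => zd.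
have [l zl] := vertex_tile Sz; exists (Y z); last by lra.
by exists l; [apply/asboolP; exists (X z)|exists z].
Qed.

Section Lengths.
Variable th : R.
Hypothesis irr : forall p q : rat, ratr p + ratr q * th = 0 -> p = 0 /\ q = 0.
Variables t d : rat.
Hypothesis quad : th * th = ratr t * th + ratr d.
Hypothesis KY : forall z, Qadj th (Y z).
Hypothesis Knu : Qadj th nu.

Lemma Qadj_gap : Qadj th (nu * a - alo).
Proof.
have n0 := nu_neq0; have n1 : nu - 1 != 0.
  by rewrite subr_eq0; apply/eqP => n1; have := nu_lt1; rewrite n1 normr1 ltxx.
(* [f] absorbs the unknown shift: the relation becomes [e - f = nu * (e' - f) + Y q]. The bit in the
   index selects lower or upper ends, [false] being lower. *)
pose f := (alo - a) / (nu - 1); pose sgn (b : bool) : R := (-1) ^+ b.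
have sgn0 b : sgn b != 0 by rewrite signr_eq0.
pose e (i : label r * bool) := xget 0 [set e | is_end (sgn i.2) (labset T i.1) e].
have eP i : occurs i.1 -> is_end (sgn i.2) (labset T i.1) (e i).
  move=> iP; rewrite /e; case: xgetP => [_ _ //|no].
  by have [x xe] := exists_label_end (sgn0 i.2) iP; case: (no x).
have Kall : forall i, occurs i.1 -> Qadj th (e i - f).
  apply: (@Qadj_finite_recursion _ _ irr _ _ quad _ (fun i => occurs i.1)
    (fun i => e i - f) nu Knu n0 nu_lt1).
  move=> i /eP/(label_end_recursion (sgn0 _))[k kP [q [e' [e'E eq]]]].
  exists (k, i.2 (+) (nu < 0)) => //=.
  have -> : e (k, i.2 (+) (nu < 0)) = e'.
    apply: (is_end_uniq (sgn0 (i.2 (+) (nu < 0))) (eP (k, _) kP)).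
    have -> : sgn (i.2 (+) (nu < 0)) = `|nu|^-1 * (sgn i.2 * nu).
      have en : nu = (-1) ^+ (nu < 0)%R * `|nu| by apply: realEsign; exact: num_real.
      transitivity (`|nu|^-1 * (sgn i.2 * ((-1) ^+ (nu < 0)%R * `|nu|))); last by rewrite -en.
      by rewrite /sgn signr_addb; field; rewrite normr_eq0.
    by apply: is_end_scale => //; rewrite invr_gt0 normr_gt0.
  have -> : e i - f - nu * (e' - f) = Y q; last exact: KY.
  have -> : e i = nu * e' + Y q - (alo - a) by rewrite -eq addrK.
  by rewrite /f; field.
have [l lP la] := is_end_union strip_lower_end.
have ea : e (l, false) = a.
  by apply: is_end_uniq (sgn0 false) (eP (l, false) lP) _; rewrite /sgn expr0.
have -> : nu * a - alo = (nu - 1) * (e (l, false) - f) by rewrite ea /f; field.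
apply: (QadjM quad); last exact: Kall.
by apply: QadjB => //; rewrite -(rmorph1 ratr); exact: Qadj_rat.
Qed.

End Lengths.

End Backward.

(** * From a substitution rule to its window *)

Section Converse.
Variables (R : realType) (v w : 'cV[R]_2) (M : 'M[int]_2) (lam mu : R).
Hypothesis v0 : v 0 0 != 0.
Hypothesis w0 : w 0 0 != 0.
Hypothesis vw : det2 v w != 0.
Hypothesis M_unit : M \in unitmx.
Hypothesis lam_gt1 : 1 < lam.
Hypothesis Mv : zmat R M *m v = lam *: v.
Hypothesis mu_lt1 : `|mu| < 1.
Hypothesis Mw : zmat R M *m w = mu *: w.
Variable O : window R.
Hypothesis O_len : Qadj lam (wlen O).
Variables (r : subst_rule R) (T : set (R * label r)) (N : 'M[int]_2).
Hypothesis T_labels : labels v w O T.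
Hypothesis T_subst : is_subst_tiling T.
Hypothesis N_assoc : associated_matrix v w O T N.

Notation X := (physc v w).
Notation Y := (internal v).
Notation L := (inflation r).
Notation S := [set z | win (wlen O) (wside O) (Y z - wlo O)].

Let C := lattice_cutproj v0 w0 vw M_unit lam_gt1 Mv mu_lt1 Mw.
Notation step := (nstep C (wlen O) (wside O)).
Let X_inj : injective X := physc_inj w0 vw M_unit mu_lt1 Mw.
Let Y_inj : injective Y := internal_inj v0 M_unit lam_gt1 Mv.
Let len_gt0 := wlen_gt0 O.

Lemma strip_latticeS z : strip_lattice v O z <-> S z.
Proof. by rewrite strip_latticeE// wsetE. Qed.

Let T_tiling : is_tiling T. Proof. by case: T_labels. Qed.

Let T_vertices : vertices T =
  [set px C z | z in [set z | win (wlen O) (wside O) (py C z - wlo O)]].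
Proof.
case: T_labels => _ ->; rewrite (proj_verticesE w v0); congr image.
by apply/seteqP; split=> z /= /wsetE.
Qed.

(** [associated_matrix] concerns tiles of a predecessor; the tile over this step recurs there by
    local isomorphism, and its inflation begins and ends at vertices of [T]. *)
Lemma step_inflated z : S z ->
  X (N *m step (Y z - wlo O)) = L * X (step (Y z - wlo O)).
Proof.
move=> Sz; set d := step _.
have d0 : 0 < X d := nstep_gt0 C len_gt0 Sz.
have Sd : S (z + d).
  by rewrite /= raddfD addrAC; exact: (nstep_win C len_gt0 Sz).
have dmin z' : S z' -> X z < X z' -> X (z + d) <= X z'.
  move=> Sz' zz'; rewrite raddfD -lerBrDl -raddfB.
  apply: (@nstep_le _ _ C _ len_gt0 (wside O) (Y z - wlo O)) => //.
    by rewrite [px _ _]raddfB subr_gt0.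
  by rewrite [py _ _]raddfB addrC addrA subrK.
have [l zl] : exists l, T (X z, l).
  have : vertices T (X z) by rewrite T_vertices; exists z.
  by move=> [[x l] Txl /= <-]; exists l.
have tl : tlen l = X d.
  apply/eqP; rewrite eq_le; apply/andP; split.
    have := @tiling_consecutive _ _ T (X z, l) (X (z + d)) T_tiling zl.
    rewrite T_vertices /= raddfD lerD2l; apply; last by rewrite ltrDl.
    by exists (z + d) => //; rewrite [LHS]raddfD.
  have := tiling_end T_tiling zl; rewrite T_vertices /= => -[z' Sz' z'E].
  have := dmin z' Sz'; rewrite [X z']z'E raddfD lerD2l ltrDl; apply.
  exact: tlen_gt0.
have [T1 [T1t [TT1 T1T] T1E]] := T_subst.2 1%N; rewrite /= in T1E.
have [||c hc] := TT1 [set (X z, l)]; first exact: finite_set1.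
  by move=> _ ->.
have T1l : T1 (X z + c, l) by apply: hc; exists (X z, l).
have vertex x : vertices (subst T1) x -> exists2 u, S u & X u = x.
  by rewrite T1E T_vertices.
have [u Su uE] := vertex _ (subst_start T1l).
have [u' Su' u'E] := vertex _ (subst_end T1t T1l).
have dstep : staircase_step v w O d.
  exists z; split; first exact/strip_latticeS; first exact/strip_latticeS.
    by rewrite -/(X z) -/(X (z + d)) raddfD ltrDl.
  move=> x; rewrite (proj_verticesE w v0) => -[z' /wsetE Sz' <-] /andP[h1].
  by rewrite ltNge -/(X (z + d)) dmin.
have := N_assoc T1t (conj TT1 T1T) T1E T1l dstep tl.
move=> /(_ u u' (iffRL (strip_latticeS u) Su) uE (iffRL (strip_latticeS u') Su') u'E) <-.
by rewrite [LHS]raddfB /= uE u'E /= tl; ring.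
Qed.

Lemma walk_inflated z n : S z ->
  let g := walk C (wlen O) (wside O) (Y z - wlo O) n in X (N *m g) = L * X g.
Proof.
elim: n z => [|n IH] z Sz /=; first by rewrite mulmx0 raddf0 mulr0.
have Sd : S (z + step (Y z - wlo O)).
  by rewrite /= raddfD addrAC; exact: (nstep_win C len_gt0 Sz).
have := IH _ Sd; rewrite /= raddfD addrAC => h.
by rewrite mulmxDr !raddfD /= mulrDr h step_inflated.
Qed.

(** A vector with height below [wlen O] is a difference of two strip points, hence up to sign a sum
    of steps. Subtracting a multiple of such a vector [q] brings any [z] to this case. *)
Lemma inflated z : X (N *m z) = L * X z.
Proof.
have diff z1 z2 : S z1 -> S z2 -> X z1 <= X z2 -> X (N *m (z2 - z1)) = L * X (z2 - z1).
  move=> S1 S2 le12; have [||n <-] := @walkP _ _ C _ len_gt0 _ _ (z2 - z1) S1.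
  - by rewrite [py _ _]raddfB addrC addrA subrK.
  - by rewrite [px _ _]raddfB subr_ge0.
  exact: walk_inflated.
have small g : `|Y g| < wlen O -> X (N *m g) = L * X g.
  move=> gl; have : Num.max (wlo O) (wlo O - Y g) <
      Num.min (wlo O + wlen O) (wlo O + wlen O - Y g).
    have l0 := len_gt0; move: gl; rewrite ltr_norml => gl.
    by rewrite lt_min !gt_max; apply/andP; split; apply/andP; split; lra.
  move=> /(@py_dense _ _ C)[z1]; rewrite gt_max lt_min => /andP[/andP[h1 h2] /andP[h3 h4]].
  have S1 : S z1 by apply: win_open; apply/andP; split; [rewrite subr_gt0|rewrite ltrBlDl].
  have S2 : S (z1 + g).
    apply: win_open; rewrite raddfD.
    have {}h2 : wlo O - Y g < Y z1 := h2.
    have {}h4 : Y z1 < wlo O + wlen O - Y g := h4.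
    by rewrite /=; lra.
  have [le|/ltW le] := leP (X z1) (X (z1 + g)).
    by have := diff _ _ S1 S2 le; rewrite addrC addKr.
  have := diff _ _ S2 S1 le; rewrite opprD addrA subrr add0r mulmxN !raddfN.
  by rewrite mulrN => /oppr_inj.
have [q [_ /andP[q0 ql]]] := cp_up C len_gt0.
have {}q0 : 0 < Y q := q0; have {}ql : Y q < wlen O := ql.
pose m := Num.floor (Y z / Y q).
have hq := small q; rewrite gtr0_norm// in hq.
have hz : X (N *m (z - q *~ m)) = L * X (z - q *~ m).
  apply: small; rewrite raddfB raddfMz -mulrzl /=.
  have := floor_le_tmp (Y z / Y q); have := floorD1_gt (Y z / Y q).
  rewrite -/m intrD ltr_pdivrMr// => h1; rewrite ler_pdivlMr// => h2.
  by rewrite ger0_norm; lra.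
have e : N *m (q *~ m) = (N *m q) *~ m by rewrite -[RHS](raddfMz (mulmx N)).
have e1 : X (N *m (z - q *~ m)) = X (N *m z) - X (N *m q) *~ m.
  by rewrite mulmxBr [LHS]raddfB e; congr (_ - _); exact: raddfMz.
have e2 : X (z - q *~ m) = X z - X q *~ m.
  by rewrite [LHS]raddfB; congr (_ - _); exact: raddfMz.
by move: hz; rewrite e1 e2 hq// mulrBr mulrzAr => /addIr.
Qed.

(** [N] and [M] both scale the injective coordinate along V, so they commute; as [M] has distinct
    eigenvalues, [N] preserves both eigenlines. *)
Lemma assoc_eigen : zmat R N *m v = L *: v.
Proof.
have NM : N *m M = M *m N.
  apply/matrixP => i j.
  have e (z : 'cV[int]_2) : N *m M *m z = M *m N *m z.
    apply: X_inj; rewrite -!mulmxA inflated !(physcM vw Mv Mw) inflated.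
    by ring.
  have := e (delta_mx j 0) => /matrixP/(_ i 0).
  by rewrite -!colE ![col _ _ _ _]mxE.
have zNM : zmat R N *m zmat R M = zmat R M *m zmat R N by rewrite -!map_mxM NM.
have mu_lam : lam - mu != 0.
  by rewrite subr_eq0; apply/eqP => e; have := ler_norm mu; move: mu_lt1 lam_gt1; rewrite e;
    lra.
have [b Nv] := pcoordP (zmat R N *m v) vw; set al := pcoord _ _ _ in Nv.
have b0 : b *: w = 0.
  have : zmat R M *m (zmat R N *m v) = lam *: (zmat R N *m v).
    by rewrite mulmxA -zNM -mulmxA Mv -scalemxAr.
  rewrite Nv mulmxDr -!scalemxAr Mv Mw scalerDr !scalerA [al * lam]mulrC.
  move=> /addrI /eqP; rewrite -subr_eq0 -scalerBl [b * mu]mulrC -mulrBl.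
  rewrite scaler_eq0 mulf_eq0 -opprB oppr_eq0 (negPf mu_lam) /= => /orP[/eqP->|/eqP->].
    by rewrite scale0r.
  by rewrite scaler0.
have [c Nw] : exists c, zmat R N *m w = c *: w.
  have [c Nw] := pcoordP (zmat R N *m w) vw; exists c; move: Nw; set ga := pcoord _ _ _ => Nw.
  have : zmat R M *m (zmat R N *m w) = mu *: (zmat R N *m w).
    by rewrite mulmxA -zNM -mulmxA Mw -scalemxAr.
  rewrite Nw mulmxDr -!scalemxAr Mv Mw scalerDr !scalerA [c * mu]mulrC.
  move=> /addIr /eqP; rewrite -subr_eq0 -scalerBl [ga * lam]mulrC -mulrBl.
  rewrite scaler_eq0 mulf_eq0 (negPf mu_lam) /= => /orP[/eqP->|/eqP vz].
    by rewrite scale0r add0r.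
  by move: v0; rewrite vz mxE eqxx.
rewrite Nv b0 addr0; congr (_ *: _).
have [q [q0 _]] := cp_up C ltr01; apply: (mulIf (lt0r_neq0 q0)).
rewrite -[RHS]inflated /physc /PiV zvecM.
have [y qE] := pcoordP (zvec R q) vw.
rewrite [X in _ *m X]qE mulmxDr -!scalemxAr Nv Nw b0 addr0.
rewrite pcoordD !pcoordZ pcoord_ker pcoord_id// !mulr0 addr0 mulr1 mulrC.
by [].
Qed.

Lemma converse : exists O' : window R,
  admissible_window v N L O O' /\
  exists2 O1 : window R, same_ends O1 O' & labels v w O1 (subst T).
Proof.
have Nv := assoc_eigen; pose nu := PiY v (zmat R N *m yvec R).
have PN z : PiY v (zmat R N *m z) = nu * PiY v z by exact: PiY_mulmx Nv.
have YN z : Y (N *m z) = nu * Y z by rewrite /internal zvecM PN.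
have T_iso := subst_loc_iso T_subst.
pose Na : {additive 'cV[int]_2 -> 'cV[int]_2} := mulmx N.
have XNa z : px C (Na z) = L * px C z by exact: inflated.
have YNa z : py C (Na z) = nu * py C z by exact: YN.
have L1 := inflation_gt1 r.
have nu0 : nu != 0 := nu_neq0 XNa YNa.
have nu1 : `|nu| < 1 := nu_lt1 len_gt0 T_vertices T_iso XNa YNa.
have nuL : nu != L by apply/eqP => e; have := ler_norm nu; move: nu1 L1; rewrite -e; lra.
have mu_lam : mu != lam.
  by apply/eqP => e; have := ler_norm mu; move: mu_lt1 lam_gt1; rewrite -e; lra.
have irr := slope_irrational v0 Y_inj.
have [t [d quad]] := slope_quadratic v0 Y_inj Nv YN nuL.
have KL := Qadj_eigen v0 Y_inj Nv YN nuL.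
have Klam := Qadj_eigen v0 Y_inj Mv (internalM v0 vw Mv Mw) mu_lam.
have Kl : Qadj L (wlen O) by rewrite KL -Klam.
have Knu : Qadj L nu.
  have : nu * 1 = Y (N *m e1) by rewrite YN internal_e1.
  by rewrite mulr1 KL => ->; exact: Qadj_internal.
pose lo := alo C T.
have Kgap : Qadj L (nu * wlo O - lo).
  rewrite KL in Knu *.
  exact: (Qadj_gap len_gt0 T_tiling T_vertices T_iso XNa YNa irr quad (Qadj_internal v0) Knu).
have bnd := lift_bound len_gt0 T_vertices T_iso XNa YNa.
have lohi : lo < lo + wlen O by rewrite ltrDl.
have [U [UE Us Ulo Uhi]] := scale_window O nu0.
(* Closed at the same end as the image window, so that inclusion (ii) holds at a shared end. The
   kind realised by the tiling comes from [lift_window] and may differ. *)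
pose O' := @Window R (wside U) _ _ lohi.
have hiE : whi O = wlo O + wlen O by rewrite /wlen; ring.
have b1 : lo <= nu * wlo O <= lo + wlen O by apply: bnd; rewrite lexx lerDl ltW.
have b2 : lo <= nu * whi O <= lo + wlen O by apply: bnd; rewrite hiE lexx lerDl ltW.
have UO' : wset U `<=` wset O'.
  have : lo <= wlo U /\ whi U <= lo + wlen O.
    by rewrite Ulo Uhi; case: (nu < 0); lra.
  move=> [h1 h2] x; rewrite /wset /= !in_itv /=; case: (wside U) => /= h; lra.
exists O'; split.
  split; first by rewrite {1}/wlen /= addrAC subrr add0r.
    by apply/(strip_imageE v0 PN); rewrite -UE.
  rewrite (PiYM_E v0 PN) -UE => y yg.
  have Ksub a b : Qadj L a -> Qadj L b -> Qadj L (a - b).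
    by rewrite KL; exact: QadjB.
  have Kadd a b : Qadj L a -> Qadj L b -> Qadj L (a + b).
    by rewrite KL; exact: QadjD.
  have Kmul a b : Qadj L a -> Qadj L b -> Qadj L (a * b).
    by rewrite KL; exact: (QadjM quad).
  have g2 : Qadj L (nu * whi O - lo).
    have -> : nu * whi O - lo = nu * wlo O - lo + nu * wlen O by rewrite hiE; ring.
    by apply: Kadd => //; exact: Kmul.
  have [->|->] := ilen_gap UO' yg; rewrite ?Ulo ?Uhi /=.
    by case: ifP.
  have E x : lo + wlen O - x = wlen O - (x - lo) by ring.
  by rewrite E; case: ifP => _; exact: Ksub.
have [s' s'E] := lift_window len_gt0 T_tiling T_vertices T_iso XNa.
exists (@Window R s' _ _ lohi); first by split.
split; first exact: subst_tiling.
rewrite (proj_verticesE w v0); apply/seteqP; split=> x.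
  move=> vx; have [z xE] := subst_vertex T_tiling T_vertices T_iso XNa vx.
  exists z; last by rewrite xE.
  apply/wsetE; rewrite /wlen /= addrAC subrr add0r; apply/s'E.
  by rewrite /is_lift -xE.
move=> [z /wsetE]; rewrite /wlen /= addrAC subrr add0r => /s'E zl <-; exact: zl.
Qed.

End Converse.

Theorem theorem2p2 (R : realType) (v w : 'cV[R]_2) (M : 'M[int]_2)
    (lam mu : R) (O : window R)
    (v_axes : v 0 0 != 0 /\ v 1 0 != 0)
    (w_axes : w 0 0 != 0 /\ w 1 0 != 0)
    (vw_distinct : det2 v w != 0)
    (M_GL : M \in unitmx)
    (M_primitive : exists n : nat, forall i j, (M ^+ n) i j != 0)
    (lam_gt1 : 1 < lam)
    (V_expanding : zmat R M *m v = lam *: v)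
    (mu_lt1 : `|mu| < 1)
    (W_contracting : zmat R M *m w = mu *: w)
    (O_nonperiodic : nonperiodic (proj_vertices v w O))
    (O_subst : is_geom_subst_tiling v w O)
    (O_len : Qadj lam (wlen O)) :
  (forall O' : window R,
     admissible_window v M lam O O' -> matching_ends v M O O' ->
     exists (s : subst_rule R) (T : set (R * label s)),
       [/\ inflation s = lam,
           labels v w O T /\ is_subst_tiling T,
           associated_matrix v w O T M,
           labels v w O' (subst T) &
           loc_iso T (subst T)]) /\
  (forall (s : subst_rule R) (T : set (R * label s)) (N : 'M[int]_2),
     labels v w O T -> is_subst_tiling T -> associated_matrix v w O T N ->
     exists O' : window R,
       admissible_window v N (inflation s) O O' /\
       exists2 O1 : window R, same_ends O1 O' & labels v w O1 (subst T)).
Proof.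
have [[v0 _] [w0 _]] := (v_axes, w_axes); split.
  by move=> O';
    apply: (forward v0 w0 vw_distinct M_GL lam_gt1 V_expanding mu_lt1 W_contracting).
move=> s T N Tl Ts Na.
exact: (converse v0 w0 vw_distinct M_GL lam_gt1 V_expanding mu_lt1 W_contracting O_len Tl Ts Na).
Qed.
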